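(* Let $T_G$ be an ergodic one-sided Markov shift corresponding to a $\rho$-uniform stochastic graph $G$ and let $\phi\in\mathcal{H}om(G,I)$. Then the semigroup $\mathcal S(\phi)$ is $d$-contractive on $G^{(0)}$ and $$d=d(\mathcal S(\phi))=d(T_G,\delta_\phi)=d(\phi).$$
   Context: **Stochastic graphs and Markov shifts.** A stochastic graph $(G,p)$ is a directed graph with countable (finite or infinite) edge set $G$, vertex set $G^{(0)}$, start and terminal maps $s,t:G\to G^{(0)}$, such that $G_u=\{g:s(g)=u\}$ and ${}_vG=\{g:t(g)=v\}$ are nonempty for all vertices, with weights $p(g)>0$ satisfying $\sum_{g\in G_u}p(g)=1$ for every $u$. Standing assumption (positive recurrence): there are stationary probabilities $p^{(0)}(u)>0$ with $\sum_u p^{(0)}(u)=1$ and $\sum_{g\in {}_vG}p(g)p^{(0)}(s(g))=p^{(0)}(v)$ for all $v$. Let $X_G=\{(x_n)_{n\ge1}\in G^{\mathbb N}: s(x_n)=t(x_{n+1})\ \forall n\}$, with $m_G(x_1=g_1,\dots,x_n=g_n)=p(g_1)\cdots p(g_n)p^{(0)}(s(g_n))$ on cylinders; the one-sided Markov shift is $T_G(x_n)=(x_{n+1})$. It is ergodic iff $G$ is irreducible (any two vertices $u,v$ are joined by a directed path from $u$ to $v$). **Homomorphisms.** A homomorphism $\phi:G\to H$ is a map of edges for which there is $\phi^{(0)}:G^{(0)}\to H^{(0)}$ with $s(\phi(g))=\phi^{(0)}(s(g))$, $t(\phi(g))=\phi^{(0)}(t(g))$, $\phi^{(0)}$ surjective,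 $\phi|_{G_u}:G_u\to H_{\phi^{(0)}(u)}$ bijective for every $u$, and $p(\phi(g))=p(g)$; $\mathcal{H}om(G,H)$ is the set of homomorphisms. The factor map is $\Phi_\phi:X_G\to X_H$, $(x_n)\mapsto(\phi(x_n))$. The degree $d(\phi)$ is the integer $d$ such that for a.e. $x\in X_H$ the fibre $\Phi_\phi^{-1}(x)$ consists of $d$ points (mod null sets: the conditional measures of $m_G$ on fibres are uniform on $d$ points). **Bernoulli graph.** $I$ finite or countable, $\rho(i)>0$, $\sum_{i\in I}\rho(i)=1$; $(I,\rho)$ is the stochastic graph with edge set $I$, weights $\rho(i)$ and a single vertex. $G$ is $\rho$-uniform if $\mathcal{H}om(G,I)\ne\emptyset$. **Index.** For $\phi\in\mathcal{H}om(G,I)$ let $\delta_\phi=\{B(i)\}_{i\in I}$ with $B(i)=\{x\in X_G:\phi(x_1)=i\}$, and $\delta_\phi^{(\infty)}=\bigvee_{n\ge1}T_G^{-n+1}\delta_\phi$. $d(T_G,\delta_\phi)$ is the number such that the conditional measure of $\{x\}$ in its element of $\delta_\phi^{(\infty)}$ equals $1/d(T_G,\delta_\phi)$ for a.e. $x\in X_G$ (it exists by ergodicity). **Semigroup $\mathcal S(\phi)$.** For $i\in I$, $u\in G^{(0)}$ let $g_{i,u}$ be the unique edge with $s(g_{i,u})=u$, $\phi(g_{i,u})=i$, and put $f_i(u)=t(g_{i,u})$. $\mathcal S(\phi)$ is the semigroup of maps $G^{(0)}\to G^{(0)}$ generated under composition by $\{f_i:i\in I\}$. **$d$-contractive semigroups.**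 Let $\mathcal S$ be a semigroup of maps of a countable set $U$ to itself and $d\in\mathbb N$. $\mathcal S$ is $d$-contractive if there is $L\subseteq U$ such that (i) $|f(L)|=|L|=d$ for all $f\in\mathcal S$; (ii) for every finite $E\subset U$ there is $f\in\mathcal S$ with $f(E)\subseteq L$. Also $d(\mathcal S)=\sup_{E\subseteq U,\ |E|<\infty}\ \min_{f\in\mathcal S}|f(E)|$. *)

(* Defs.v *)
From HB Require Import structures.
From mathcomp Require Import all_boot all_order all_algebra finmap.
From mathcomp Require Import all_classical all_reals all_analysis.

Set Implicit Arguments.
Unset Strict Implicit.
Unset Printing Implicit Defensive.

Import Order.TTheory GRing.Theory Num.Theory.
Import numFieldNormedType.Exports.

Local Open Scope classical_set_scope.
Local Open Scope ring_scope.

(* The stationary probabilities (positive recurrence) are part of the data. *)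
Record stochGraph (R : realType) := StochGraph {
  edge : countType;
  vertex : countType;
  src : edge -> vertex;
  trm : edge -> vertex;
  wt : edge -> R;
  p0 : vertex -> R;
  src_surj : forall u, exists g, src g = u;
  trm_surj : forall v, exists g, trm g = v;
  wt_gt0 : forall g, 0 < wt g;
  wt_sum1 : forall u, (\esum_(g in [set g | src g = u]) (wt g)%:E = 1)%E;
  p0_gt0 : forall u, 0 < p0 u;
  p0_sum1 : (\esum_(u in [set: vertex]) (p0 u)%:E = 1)%E;
  p0_stationary : forall v,
    (\esum_(g in [set g | trm g = v]) (wt g * p0 (src g))%:E = (p0 v)%:E)%E
}.

Arguments src {R} s _.
Arguments trm {R} s _.
Arguments wt {R} s _.
Arguments p0 {R} s _.

(* Coordinates are numbered from 0: the paper's x_(n+1) is [x n]. *)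
Record path_space (R : realType) (G : stochGraph R) := PathSpace {
  path_seq :> nat -> edge G;
  path_adj : forall n, src G (path_seq n) = trm G (path_seq n.+1)
}.

Section path_space_measurable.
Variables (R : realType) (G : stochGraph R).

Lemma edge_ex : exists g : edge G, True.
Proof.
have [[u _]|noV] := pselect (exists u : vertex G, True).
  by have [g _] := src_surj u; exists g.
have := p0_sum1 G; rewrite esum1; first by move/eqP; rewrite eqe eq_sym oner_eq0.
by move=> u _; case: noV; exists u.
Qed.

Definition path_point_seq : nat -> edge G :=
  nat_rect (fun=> edge G) (sval (cid edge_ex))
    (fun _ g => sval (cid (trm_surj (src G g)))).

Lemma path_point_adj n :
  src G (path_point_seq n) = trm G (path_point_seq n.+1).
Proof. by rewrite /=; case: cid. Qed.

HB.instance Definition _ := gen_eqMixin (path_space G).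
HB.instance Definition _ := gen_choiceMixin (path_space G).
HB.instance Definition _ :=
  isPointed.Build (path_space G) (PathSpace path_point_adj).

Definition cylinder (n : nat) (g : nat -> edge G) : set (path_space G) :=
  [set x : path_space G | forall k, (k <= n)%N -> x k = g k].

Definition cylinders : set (set (path_space G)) :=
  [set A | exists n g, A = cylinder n g].

HB.instance Definition _ := @isMeasurable.Build (sigma_display cylinders)
  (path_space G) <<s cylinders >>
  (@sigma_algebra0 _ setT cylinders) (@sigma_algebraC _ cylinders)
  (@sigma_algebra_bigcup _ setT cylinders).

Definition markov_shift (x : path_space G) : path_space G :=
  PathSpace (fun n => path_adj x n.+1).

(* This determines m uniquely: it is the measure m_G. *)
Definition is_markov_measure (m : probability (path_space G) R) :=
  forall (n : nat) (g : nat -> edge G),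
    (forall k, (k < n)%N -> src G (g k) = trm G (g k.+1)) ->
    m (cylinder n g) = ((\prod_(k < n.+1) wt G (g k)) * p0 G (src G (g n)))%:E.

End path_space_measurable.

Record graph_hom (R : realType) (G H : stochGraph R) := Hom {
  hom_edge :> edge G -> edge H;
  hom_vertex : vertex G -> vertex H;
  hom_src : forall g, src H (hom_edge g) = hom_vertex (src G g);
  hom_trm : forall g, trm H (hom_edge g) = hom_vertex (trm G g);
  hom_vertex_surj : forall v, exists u, hom_vertex u = v;
  hom_bij : forall u,
    set_bij [set g | src G g = u] [set h | src H h = hom_vertex u] hom_edge;
  hom_wt : forall g, wt H (hom_edge g) = wt G g
}.

Section factor_map.
Variables (R : realType) (G H : stochGraph R) (phi : graph_hom G H).

Lemma factor_adj (x : path_space G) n :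
  src H (phi (x n)) = trm H (phi (x n.+1)).
Proof. by rewrite hom_src hom_trm path_adj. Qed.

Definition factor_map (x : path_space G) : path_space H :=
  PathSpace (factor_adj x).

End factor_map.

Section conditional_measures.
Context {R : realType} {d : measure_display} {X : measurableType d}.
Implicit Types (T : X -> X) (xi delta : set (set X)).

(* Invariant sets of positive measure have full measure; the invariance of m
   itself under T is a separate property. *)
Definition ergodic (m : probability X R) T :=
  forall A, measurable A -> T @^-1` A = A -> m A = 0%E \/ m A = 1%E.

(* Conditional measures of m on the fibres of f : X -> Y, for m mapped to mY;
   when Y is countably generated with measurable points they are unique up to
   an mY-null set. *)
Definition fibre_measures {d' : measure_display} {Y : measurableType d'}
    (m : probability X R) (mY : probability Y R) (f : X -> Y)
    (k : R.-pker Y ~> X) :=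
  (\forall y \ae mY, k y (f @^-1` [set y]) = 1%E) /\
  (forall A, measurable A -> m A = (\int[mY]_y k y A)%E).

(* Conditional measures (Rokhlin's canonical system) of a partition xi of X:
   k x is the conditional measure on the element of xi that contains x. *)
Definition partition_measures (m : probability X R) xi (k : R.-pker X ~> X) :=
  [/\ forall C x y, xi C -> C x -> C y ->
        forall A, measurable A -> k x A = k y A,
      \forall x \ae m, forall C, xi C -> C x -> k x C = 1%E &
      forall A, measurable A -> m A = (\int[m]_x k x A)%E].

(* The join of the partitions T^(-n) delta, n >= 0. *)
Definition join_preimages T delta : set (set X) :=
  [set C | C !=set0 /\ exists A : nat -> set X,
     (forall n, delta (A n)) /\ C = \bigcap_n (iter n T @^-1` A n)].

(* d(T, delta) = r *)
Definition is_index (m : probability X R) T delta (r : R) :=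
  0 < r /\ exists k : R.-pker X ~> X,
    partition_measures m (join_preimages T delta) k /\
    \forall x \ae m, k x [set x] = (r^-1)%:E.

End conditional_measures.

(* d(phi) = n *)
Definition is_degree (R : realType) (G H : stochGraph R)
    (mG : probability (path_space G) R) (mH : probability (path_space H) R)
    (phi : graph_hom G H) (n : nat) :=
  exists k : R.-pker (path_space H) ~> (path_space G),
    fibre_measures mG mH (factor_map phi) k /\
    \forall y \ae mH, exists F : set (path_space G),
      [/\ F `<=` factor_map phi @^-1` [set y], (F #= `I_n)%card, k y F = 1%E &
          forall x, F x -> k y [set x] = (n%:R^-1)%:E].

Section bernoulli.
Variables (R : realType) (I : countType) (rho : I -> R).
Hypothesis rho_gt0 : forall i, 0 < rho i.
Hypothesis rho_sum1 : (\esum_(i in [set: I]) (rho i)%:E = 1)%E.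

Lemma bernoulli_surj (u : unit) : exists i : I, tt = u.
Proof.
case: u; have [[i _]|noI] := pselect (exists i : I, True); first by exists i.
move: rho_sum1; rewrite esum1; first by move/eqP; rewrite eqe eq_sym oner_eq0.
by move=> i _; case: noI; exists i.
Qed.

Lemma bernoulli_wt_sum1 (u : unit) :
  (\esum_(i in [set i : I | tt = u]) (rho i)%:E = 1)%E.
Proof.
by rewrite -[RHS]rho_sum1; congr esum; apply/seteqP; split=> // i _; case: u.
Qed.

Lemma bernoulli_p0_sum1 : (\esum_(u in [set: unit]) (1 : R)%:E = 1)%E.
Proof.
have -> : [set: unit] = [set tt] by apply/seteqP; split=> // -[].
by rewrite esum_set1 // lee_fin.
Qed.

Lemma bernoulli_stationary (v : unit) :
  (\esum_(i in [set i : I | tt = v]) (rho i * 1)%:E = (1 : R)%:E)%E.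
Proof. by under eq_esum do rewrite mulr1; exact: bernoulli_wt_sum1. Qed.

Definition bernoulli_graph : stochGraph R :=
  @StochGraph R I unit (fun=> tt) (fun=> tt) rho (fun=> 1)
    bernoulli_surj bernoulli_surj rho_gt0 bernoulli_wt_sum1
    (fun=> ltr01) bernoulli_p0_sum1 bernoulli_stationary.

Definition rho_uniform (G : stochGraph R) :=
  inhabited (graph_hom G bernoulli_graph).

Variables (G : stochGraph R) (phi : graph_hom G bernoulli_graph).

Definition delta_partition : set (set (path_space G)) :=
  [set [set x : path_space G | phi (x 0%N) = i] | i in [set: I]].

Lemma lift_edge_ex (i : I) (u : vertex G) :
  exists! g : edge G, src G g = u /\ phi g = i.
Proof.
have [_ phi_inj phi_surj] := hom_bij phi u.
have [|g gu gi] := phi_surj i; first by case: (hom_vertex phi u).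
exists g; split=> // h [hu hi].
by apply: phi_inj; rewrite ?inE //= gi hi.
Qed.

(* The edge g_(i,u); vertex_map i is the map f_i. *)
Definition lift_edge (i : I) (u : vertex G) : edge G :=
  sval (cid (lift_edge_ex i u)).

Definition vertex_map (i : I) (u : vertex G) : vertex G :=
  trm G (lift_edge i u).

End bernoulli.

Inductive generated_semigroup (I U : Type) (f : I -> U -> U) : set (U -> U) :=
| generated_gen i : generated_semigroup f (f i)
| generated_comp g h : generated_semigroup f g -> generated_semigroup f h ->
    generated_semigroup f (g \o h).

(* S(phi) *)
Definition vertex_semigroup (R : realType) (I : countType) (rho : I -> R)
    (rho_gt0 : forall i, 0 < rho i)
    (rho_sum1 : (\esum_(i in [set: I]) (rho i)%:E = 1)%E)
    (G : stochGraph R) (phi : graph_hom G (bernoulli_graph rho_gt0 rho_sum1)) :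
    set (vertex G -> vertex G) :=
  generated_semigroup (vertex_map phi).

Section contractive.
Variable U : countType.
Local Open Scope fset_scope.

Definition d_contractive (d : nat) (S : set (U -> U)) :=
  exists L : {fset U},
    [/\ #|` L| = d,
        forall f, S f -> #|` [fset f x | x in L]| = d &
        forall E : {fset U}, exists2 f, S f & [fset f x | x in E] `<=` L].

(* d(S). For nonempty S the infimum is a minimum, since it is taken over naturals. *)
Definition semigroup_degree (R : realType) (S : set (U -> U)) : \bar R :=
  ereal_sup [set ereal_inf [set (#|` [fset f x | x in E]|%:R : R)%:E | f in S]
            | E in [set: {fset U}]].

End contractive.

(* Main.v *)
(* Idea. Write y = Phi x for the sequence of labels of a path x, and let h_u(y)
   be the conditional probability, given y, that x ends at the vertex u (a
   Radon-Nikodym derivative). The labels and the end vertex of T x determine the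
   end vertex of x, so H(x) = h_(end of x)(Phi x) satisfies H(T x) <= H(x), and by
   ergodicity H is a constant c. Hence every h_u only takes the values 0 and c;
   as the h_u(y) add up to 1, the set C(y) = {u : h_u(y) = c} has exactly
   d = 1/c elements, and the map f_i with i = y_0 sends C(S y) bijectively onto
   C(y). So the fibre over y carries d paths, one through each vertex of C(y),
   and the conditional measure is uniform on them; this gives d(phi) and
   d(T_G, delta_phi).
     For contractivity take a value L of C that has positive probability. Since
   C(w y) = f_w(C(y)), all f_w(L) have d elements. There are words w given which
   C(y) = L has conditional probability as close to 1 as we like, and x then
   ends in L with at least that probability: the mass of f_w^-1(L) is close
   to 1, so f_w^-1(L) contains any given finite set. *)

From HB Require Import structures.
Require Import Defs.
From mathcomp Require Import all_boot all_order all_algebra finmap ring lra.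
From mathcomp Require Import all_classical all_reals all_analysis.
From mathcomp Require Import measurable_realfun.

Set Implicit Arguments.
Unset Strict Implicit.
Unset Printing Implicit Defensive.

Import Order.TTheory GRing.Theory Num.Theory.

Local Open Scope classical_set_scope.
Local Open Scope ring_scope.

(** * Almost everywhere properties and measures on path spaces *)

Section measure_complements.
Context {d : measure_display} {T : measurableType d} {R : realType}.

Lemma measurable_bigcup_countType (K : countType) (F : K -> set T) :
  (forall k, measurable (F k)) -> measurable (\bigcup_k F k).
Proof. by apply: countable_bigcupT_measurable; exact: countableP. Qed.

Lemma measurable_bigcap_countType (K : countType) (F : K -> set T) :
  (forall k, measurable (F k)) -> measurable (\bigcap_k F k).
Proof.
move=> mF; rewrite -[X in measurable X]setCK setC_bigcap; apply: measurableC.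
by apply: measurable_bigcup_countType => k; exact: measurableC.
Qed.

Lemma measurable_cst_and (P : Prop) (A : set T) :
  (P -> measurable A) -> measurable [set x | P /\ A x].
Proof.
move=> mA; have [p|np] := pselect P.
  by rewrite (_ : [set x | _] = A); [exact: mA|apply/seteqP; split=> x //= -[]].
by rewrite (_ : [set x | _] = set0)//; apply/seteqP; split=> x //= -[].
Qed.

Variable mu : {measure set T -> \bar R}.

(** In the applications [N x] is the code of a label, a vertex or a prefix of [x], so that a sum
    over a countable type becomes a series over [nat]. *)
Lemma measure_sum_fibres (N : T -> nat) (A : set T) : measurable A ->
  (forall k, measurable (N @^-1` [set k])) ->
  mu A = (\sum_(k <oo) mu (A `&` N @^-1` [set k]))%E.
Proof.
move=> mA mN; pose F k := A `&` N @^-1` [set k].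
have -> : mu A = mu (\bigcup_k F k).
  by congr (mu _); rewrite -setI_bigcupr -preimage_bigcup bigcup_imset1 image_id
    preimage_setT setIT.
rewrite measure_bigcup//.
- by apply: eq_eseriesl => k; rewrite in_setT.
- by move=> k _; exact: measurableI.
- by apply/trivIset_setIl/trivIset_preimage1.
Qed.

Lemma ae_forall_countType (K : countType) (P : K -> T -> Prop) :
  (forall k, \forall x \ae mu, P k x) -> \forall x \ae mu, forall k, P k x.
Proof.
move=> aeP.
have : \forall x \ae mu, forall n,
    if @choice.unpickle K n is Some k then P k x else True.
  by apply: ae_foralln => n; case: (choice.unpickle n) => [k|]; [exact: aeP|exact: aeW].
by apply: filterS => x Px k; have := Px (choice.pickle k); rewrite choice.pickleK.
Qed.

Lemma ae_measure0 (P : set T) : measurable P ->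
  (\forall x \ae mu, ~ P x) -> mu P = 0%E.
Proof.
move=> mP [N [mN N0 PN]]; apply: (subset_measure0 mP mN _ N0).
by move=> x Px; apply: PN => /= /(_ Px).
Qed.

Lemma measure0_aeN (P : set T) : measurable P ->
  mu P = 0%E -> \forall x \ae mu, ~ P x.
Proof. by move=> mP P0; exists P; split=> // x /=; exact: contrapT. Qed.

Lemma le_measure_ae (A B : set T) : measurable A -> measurable B ->
  (\forall x \ae mu, A x -> B x) -> (mu A <= mu B)%E.
Proof.
move=> mA mB AB; have AB0 : mu (A `\` B) = 0%E.
  by apply: ae_measure0; [exact: measurableD|apply: filterS AB => x AB [/AB]].
have -> : mu A = (mu (A `\` B) + mu (A `&` B))%E by exact: measureDI.
rewrite AB0 add0e.
by apply: le_measure; rewrite ?inE//; exact: measurableI.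
Qed.

Lemma eq_measure_ae (A B : set T) : measurable A -> measurable B ->
  (\forall x \ae mu, A x <-> B x) -> mu A = mu B.
Proof.
move=> mA mB AB; apply/eqP; rewrite eq_le.
by apply/andP; split; apply: le_measure_ae => //; apply: filterS AB => x [].
Qed.

End measure_complements.

Section probability_complements.
Context {d : measure_display} {T : measurableType d} {R : realType}.
Variable P : probability T R.

Lemma prob1_ae (A : set T) : measurable A -> P A = 1%E -> \forall x \ae P, A x.
Proof.
move=> mA PA; exists (~` A); split=> //; first exact: measurableC.
by rewrite probability_setC// PA subee.
Qed.

Lemma ae_prob1 (A : set T) : measurable A -> (\forall x \ae P, A x) -> P A = 1%E.
Proof.
move=> mA aeA; rewrite -(@probability_setT _ _ _ P); apply: eq_measure_ae => //.
by apply: filterS aeA => x Ax; split.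
Qed.

End probability_complements.

Section measure_preserving.
Context {d d' : measure_display} {T : measurableType d} {T' : measurableType d'}.
Context {R : realType}.
Variables (mu : {measure set T -> \bar R}) (mu' : {measure set T' -> \bar R}).
Variable f : T -> T'.
Hypothesis mf : measurable_fun setT f.
Hypothesis muf : forall B, measurable B -> mu (f @^-1` B) = mu' B.

Lemma ae_preimage (P : T' -> Prop) :
  (\forall y \ae mu', P y) -> \forall x \ae mu, P (f x).
Proof.
move=> [N [mN N0 PN]]; exists (f @^-1` N); split; last by move=> x /PN.
- by rewrite -[X in measurable X]setTI; exact: mf.
- by rewrite muf.
Qed.

End measure_preserving.

Section path_space_complements.
Variables (R : realType) (G : stochGraph R).
Implicit Types x : path_space G.

Lemma path_eqP x x' : (forall n, x n = x' n) -> x = x'.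
Proof.
case: x x' => [x xP] [x' x'P] /= /funext E.
by case: _ / E x'P => x'P; congr PathSpace; exact: Prop_irrelevance.
Qed.

Definition path_prefix n x : seq (edge G) := [seq x k | k <- iota 0 n].

Lemma size_path_prefix n x : size (path_prefix n x) = n.
Proof. by rewrite size_map size_iota. Qed.

Lemma nth_path_prefix g0 n x k : (k < n)%N -> nth g0 (path_prefix n x) k = x k.
Proof. by move=> kn; rewrite (nth_map 0%N) ?size_iota// nth_iota. Qed.

Lemma path_prefixP n x x' :
  path_prefix n x = path_prefix n x' <-> forall k, (k < n)%N -> x k = x' k.
Proof.
split=> [E k kn|E].
  by rewrite -(nth_path_prefix (x 0%N) x kn) E nth_path_prefix.
by apply/eq_in_map => k; rewrite mem_iota => /andP[_]; exact: E.
Qed.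

Lemma measurable_cylinder n (g : nat -> edge G) : measurable (cylinder n g).
Proof. by apply: sub_sigma_algebra; exists n, g. Qed.

(** Finite sequences of edges form a countable type, so the set is a countable union of
    cylinders. *)
Lemma measurable_path_prefix n (P : set (seq (edge G))) :
  measurable [set x : path_space G | P (path_prefix n x)].
Proof.
(* [cylinder n] fixes the [n.+1] coordinates from 0 to [n], so the empty prefix is a separate
   case. *)
case: n => [|n].
  rewrite (_ : [set x | _] = [set x | P [::] /\ setT x]).
    exact: measurable_cst_and.
  by apply/seteqP; split=> x //= -[].
rewrite (_ : [set x | _] =
    \bigcup_s [set x : path_space G | P s /\ cylinder n (nth (x 0%N) s) x
       /\ size s = n.+1]).
  apply: measurable_bigcup_countType => s; apply: measurable_cst_and => _.
  have [sn|sn] := eqVneq (size s) n.+1; last first.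
    rewrite [X in measurable X](_ : _ = set0)//.
    by apply/seteqP; split=> // x /= [_ /eqP]; rewrite (negbTE sn).
  case: s sn => // g0 s sn.
  rewrite [X in measurable X](_ : _ = cylinder n (nth g0 (g0 :: s))).
    exact: measurable_cylinder.
  apply/seteqP; split=> x /=.
    by move=> [xs _] k kn; rewrite xs//; apply: set_nth_default; rewrite sn.
  move=> xs; split=> // k kn.
  by rewrite xs//; apply: set_nth_default; rewrite sn.
apply/seteqP; split=> x /=.
  move=> Px; exists (path_prefix n.+1 x) => //; split=> //; split.
    by move=> k kn; rewrite nth_path_prefix.
  exact: size_path_prefix.
move=> [s _ [Ps [xs sn]]]; suff -> : path_prefix n.+1 x = s by [].
apply: (@eq_from_nth _ (x 0%N)); rewrite size_path_prefix ?sn// => k kn.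
by rewrite nth_path_prefix// xs.
Qed.

Lemma measurable_coord n (P : set (edge G)) :
  measurable [set x : path_space G | P (x n)].
Proof.
rewrite (_ : [set x | _] = [set x : path_space G |
    if drop n (path_prefix n.+1 x) is g :: _ then P g else True]).
  exact: (measurable_path_prefix _ (fun s => if drop n s is g :: _ then P g else True)).
apply/funext => x; rewrite /mkset /path_prefix.
by rewrite -map_drop drop_iota subSnn.
Qed.

(** Cylinders generate the measurable sets and are finite intersections of conditions on single
    coordinates. *)
Lemma measurable_fun_path d (T : measurableType d) (F : T -> path_space G) :
  (forall n g, measurable [set t | F t n = g]) -> measurable_fun setT F.
Proof.
move=> mF; apply: (@measurability _ _ _ _ _ _ (@cylinders R G)) => //.
move=> _ [_ [n [g ->]] <-]; rewrite setTI.
rewrite (_ : _ @^-1` _ = \bigcap_(k in [set k | (k <= n)%N]) [set t | F t k = g k]).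
  by apply: bigcap_measurable => //; exists 0%N.
by apply/seteqP; split.
Qed.

Lemma measurable_markov_shift : measurable_fun setT (@markov_shift R G).
Proof.
by apply: measurable_fun_path => n g; exact: (measurable_coord n.+1 [set g]).
Qed.

Lemma markov_shiftE x n : markov_shift x n = x n.+1.
Proof. by []. Qed.

Lemma iter_markov_shiftE k x n : iter k (@markov_shift R G) x n = x (k + n)%N.
Proof. by elim: k n => [|k IH] n //; rewrite iterS markov_shiftE IH addnS. Qed.

Lemma measurable_iter_shift k : measurable_fun setT (iter k (@markov_shift R G)).
Proof.
by apply: measurable_fun_path => n g; rewrite (_ : [set t | _] = [set x : path_space G |
  [set g] (x (k + n)%N)]); [exact: measurable_coord|
  apply/seteqP; split => x /=; rewrite iter_markov_shiftE].
Qed.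

End path_space_complements.

(** * Comparison of measures through their values on cylinders *)

Section path_measure_comparison.
Variables (R : realType) (G : stochGraph R).
Variables m1 m2 : {measure set (path_space G) -> \bar R}.

Let determined (A : set (path_space G)) :=
  exists n (Q : set (seq (edge G))), A = [set x | Q (path_prefix n.+1 x)].

Let determinedS A : determined A -> exists n, forall N, (n <= N)%N ->
  exists Q : set (seq (edge G)), A = [set x | Q (path_prefix N.+1 x)].
Proof.
move=> [n [Q ->]]; exists n => N nN; exists (fun s => Q (take n.+1 s)).
apply/funext => x; rewrite /mkset /path_prefix -map_take take_iota.
by rewrite (minn_idPl _).
Qed.

(** Both sets can be read off a common, long enough prefix. *)
Let determined2 (op : Prop -> Prop -> Prop) A B : determined A -> determined B ->
  determined [set x | op (A x) (B x)].
Proof.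
move=> /determinedS[n nA] /determinedS[k kB]; exists (maxn n k).
have [P PE] := nA _ (leq_maxl n k); have [Q QE] := kB _ (leq_maxr n k).
by exists (fun s => op (P s) (Q s)); rewrite {1}PE {1}QE.
Qed.

Let determined_ring : setring determined.
Proof.
split=> [|A B dA dB|A B dA dB].
- by exists 0%N, set0.
- exact: (determined2 or).
- exact: (determined2 (fun P Q => P /\ ~ Q)).
Qed.

(* The sets on which [m1 <= m2] form a monotone class, and countable additivity
   puts every set determined by finitely many coordinates in it. *)
Lemma path_measure_le : (m1 setT < +oo)%E -> (m2 setT < +oo)%E ->
  (forall n (x : path_space G), (m1 (cylinder n x) <= m2 (cylinder n x))%E) ->
  forall A, measurable A -> (m1 A <= m2 A)%E.
Proof.
move=> m1oo m2oo m12; pose M A := measurable A /\ (m1 A <= m2 A)%E.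
have fin (m : {measure set (path_space G) -> \bar R}) A :
    (m setT < +oo)%E -> measurable A -> (m A < +oo)%E.
  by move=> + mA; apply: le_lt_trans; apply: le_measure; rewrite ?inE.
have M_determined : determined `<=` M.
  move=> _ [n [Q ->]]; have mQ := measurable_path_prefix n.+1 Q; split=> //.
  pose V (x : path_space G) := choice.pickle (path_prefix n.+1 x).
  have mV k : measurable (V @^-1` [set k]).
    exact: (measurable_path_prefix n.+1 (fun s => choice.pickle s = k)).
  rewrite (measure_sum_fibres m1 mQ mV) (measure_sum_fibres m2 mQ mV).
  apply: lee_nneseries => // k _.
  pose D := [set x : path_space G | Q (path_prefix n.+1 x)] `&` V @^-1` [set k].
  rewrite -[X in (m1 X <= _)%E]/D -[X in (_ <= m2 X)%E]/D.
  have [D0|/set0P[x [Qx xk]]] := eqVneq D set0.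
    by rewrite D0 !measure0.
  suff -> : D = cylinder n x by exact: m12.
  apply/seteqP; split=> z.
    move=> [_]; rewrite /V /preimage /mkset -xk => /(pcan_inj choice.pickleK).
    by move=> /path_prefixP zx j jn; exact: zx.
  move=> zx; have E : path_prefix n.+1 z = path_prefix n.+1 x.
    by apply/path_prefixP => j jn; exact: zx.
  by split; rewrite /V /preimage /mkset E.
have M_monotone : monotone M.
  split=> F ndF MF; have mF k : measurable (F k) by have [] := MF k.
    have mU : measurable (\bigcup_k F k) by exact: bigcupT_measurable.
    split=> //.
    have c1 := nondecreasing_cvg_mu (mu := m1) mF mU ndF.
    have c2 := nondecreasing_cvg_mu (mu := m2) mF mU ndF.
    rewrite -(cvg_lim _ c1)// -(cvg_lim _ c2)//; apply: lee_lim.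
    - by apply/cvg_ex; eexists; exact: c1.
    - by apply/cvg_ex; eexists; exact: c2.
    - by near=> k; have [] := MF k.
  have mI : measurable (\bigcap_k F k) by exact: bigcapT_measurable.
  split=> //.
  have c1 := nonincreasing_cvg_mu (mu := m1) (fin _ _ m1oo (mF 0%N)) mF mI ndF.
  have c2 := nonincreasing_cvg_mu (mu := m2) (fin _ _ m2oo (mF 0%N)) mF mI ndF.
  rewrite -(cvg_lim _ c1)// -(cvg_lim _ c2)//; apply: lee_lim.
  - by apply/cvg_ex; eexists; exact: c1.
  - by apply/cvg_ex; eexists; exact: c2.
  - by near=> k; have [] := MF k.
(* Monotone class theorem for rings. Since the whole space lies in the ring, the generated
   sigma-ring is a sigma-algebra, and it contains the cylinders. *)
have sub : <<sr determined >> `<=` M.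
  rewrite -(g_monotone_g_sigma_ring determined_ring).
  exact: smallest_sub M_monotone M_determined.
suff : <<s @cylinders R G >> `<=` <<sr determined >>.
  by move=> cyl A mA; have [] := sub _ (cyl A mA).
have [r0 rD rU] := smallest_sigma_ring determined.
apply: smallest_sub.
  split=> // A rA; apply: rD => //; apply: sub_g_sigma_ring.
  by exists 0%N, setT.
move=> _ [n [g ->]]; apply: sub_g_sigma_ring.
exists n, (fun s => forall k, (k <= n)%N -> nth (g 0%N) s k = g k).
apply/seteqP; split=> x /= xg k kn; first by rewrite nth_path_prefix// xg.
by rewrite -xg// nth_path_prefix.
Unshelve. all: by end_near. Qed.

End path_measure_comparison.

Lemma path_measure_unique (R : realType) (G : stochGraph R)
    (m1 m2 : {measure set (path_space G) -> \bar R}) :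
  (m1 setT < +oo)%E -> (m2 setT < +oo)%E ->
  (forall n (x : path_space G), m1 (cylinder n x) = m2 (cylinder n x)) ->
  forall A, measurable A -> m1 A = m2 A.
Proof.
move=> m1oo m2oo m12 A mA; apply/eqP; rewrite eq_le.
by apply/andP; split; apply: path_measure_le => // n x; rewrite m12.
Qed.

Lemma image_measure d d' (T : measurableType d) (T' : measurableType d')
    (R : realType) (m : {measure set T -> \bar R}) (f : T -> T') :
  measurable_fun setT f ->
  exists m' : {measure set T' -> \bar R}, forall A, m' A = m (f @^-1` A).
Proof. by move=> mf; unshelve eexists (pushforward m f : {measure set T' -> \bar R}). Qed.

Lemma measurable_factor_map (R : realType) (G H : stochGraph R)
  (phi : graph_hom G H) : measurable_fun setT (factor_map phi).
Proof.
by apply: measurable_fun_path => n g; exact: (measurable_coord n [set h | phi h = g]).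
Qed.

(** * The shift and the factor map *)

Section bernoulli_factor.
Variables (R : realType) (G : stochGraph R) (I : countType) (rho : I -> R).
Variables (rho_gt0 : forall i, 0 < rho i).
Variables (rho_sum1 : (\esum_(i in [set: I]) (rho i)%:E = 1)%E).
Local Notation BG := (bernoulli_graph rho_gt0 rho_sum1).
Variable phi : graph_hom G BG.
Variable mG : probability (path_space G) R.
Hypothesis mG_markov : is_markov_measure mG.
Variable mI : probability (path_space BG) R.
Hypothesis mI_markov : is_markov_measure mI.

Local Notation X := (path_space G).
Local Notation Y := (path_space BG).
Local Notation T := (@markov_shift R G).
Local Notation S := (@markov_shift R BG).
Local Notation Phi := (factor_map phi).
Local Notation f := (vertex_map phi).

(* Edge [x 0] is the last one in time: the vertex [start x] is the end of the path. *)
Definition start (x : X) : vertex G := trm G (x 0%N).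

Definition label (x : X) : I := phi (x 0%N).

Lemma src_lift_edge i u : src G (lift_edge phi i u) = u.
Proof. by rewrite /lift_edge; case: cid => g /= [[]]. Qed.

Lemma hom_lift_edge i u : phi (lift_edge phi i u) = i.
Proof. by rewrite /lift_edge; case: cid => g /= [[]]. Qed.

Lemma lift_edgeK g : lift_edge phi (phi g) (src G g) = g.
Proof.
by rewrite /lift_edge; case: cid => h /= [_]; apply; split.
Qed.

Lemma vertex_map_src g : f (phi g) (src G g) = trm G g.
Proof. by rewrite /vertex_map lift_edgeK. Qed.

Lemma start_shift (x : X) : f (label x) (start (T x)) = start x.
Proof. by rewrite /start /= -path_adj vertex_map_src. Qed.

Lemma factor_map_shift (x : X) : Phi (T x) = S (Phi x).
Proof. exact: path_eqP. Qed.

Lemma factor_map_iter k (x : X) : Phi (iter k T x) = iter k S (Phi x).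
Proof. by elim: k => //= k <-; rewrite factor_map_shift. Qed.

Lemma measurable_label i : measurable [set x : X | label x = i].
Proof. exact: (measurable_coord 0 [set g | phi g = i]). Qed.

Lemma measurable_start (P : set (vertex G)) : measurable [set x : X | P (start x)].
Proof. exact: (measurable_coord 0 [set g | P (trm G g)]). Qed.

Lemma measurable_preim_shift A : measurable A -> measurable (T @^-1` A).
Proof.
by move=> mA; rewrite -[X in measurable X]setTI; exact: measurable_markov_shift.
Qed.

Lemma measurable_preim_factor B : measurable B -> measurable (Phi @^-1` B).
Proof.
by move=> mA; rewrite -[X in measurable X]setTI; exact: measurable_factor_map.
Qed.

(* The label of the last edge is independent of the rest of the path. *)
Lemma measure_label_shift i A : measurable A ->
  mG ([set x | label x = i] `&` T @^-1` A) = ((rho i)%:E * mG A)%E.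
Proof.
have r0 : 0 <= rho i by exact: ltW.
(* Both sides are finite measures in [A], so it is enough to compare them on cylinders. *)
have [m1 m1E] := image_measure (mrestr mG (measurable_label i))
  (@measurable_markov_shift R G).
rewrite setIC -[LHS]m1E -[RHS]/(mscale (NngNum r0) mG A).
apply: path_measure_unique.
- rewrite m1E preimage_setT /= /mrestr setTI (@le_lt_trans _ _ 1%E) ?ltry//.
  by apply: probability_le1; exact: measurable_label.
- by rewrite /= /mscale /= probability_setT mule1 ltry.
move=> n g; rewrite m1E /mscale /= /mrestr /=.
(* [T x] and the label [i] determine the missing edge of [x]: it is the lift of [i] that starts
   where [T x] ends. The event is thus a cylinder with this edge, of weight [rho i], put in
   front. *)
pose h k := if k is k'.+1 then g k' else lift_edge phi i (trm G (g 0%N)).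
have -> : T @^-1` cylinder n g `&` [set x | label x = i] = cylinder n.+1 h.
  apply/seteqP; split=> x.
    move=> [xg xi] [|k] //= kn; last exact: xg.
    by rewrite -xi -(xg 0%N)// /= -path_adj lift_edgeK.
  move=> xh; split; first by move=> k kn; exact: (xh k.+1).
  by rewrite /= /label xh//= hom_lift_edge.
rewrite /mscale /= !mG_markov//; last 2 first.
- by move=> k _; exact: path_adj.
- by move=> [|k] _ /=; [rewrite src_lift_edge|exact: path_adj].
by rewrite big_ord_recl/= -mulrA EFinM -(hom_wt phi) hom_lift_edge.
Qed.

Lemma measure_label i : mG [set x | label x = i] = (rho i)%:E.
Proof.
have := measure_label_shift i measurableT.
by rewrite preimage_setT setIT probability_setT mule1.
Qed.

(** Split by the label at index 0: by independence each piece is [mG A] times the mass of its label,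
    and these masses add up to 1. *)
Lemma measure_shift A : measurable A -> mG (T @^-1` A) = mG A.
Proof.
move=> mA; pose N x := choice.pickle (label x).
have mN k : measurable (N @^-1` [set k]).
  exact: (measurable_coord 0 [set g | choice.pickle (phi g : I) = k]).
have NE k : mG (T @^-1` A `&` N @^-1` [set k]) = (mG A * mG (N @^-1` [set k]))%E.
  case E : (@pickle_inv I k) => [i|].
    have <- : [set x | label x = i] = N @^-1` [set k].
      have ik : choice.pickle i = k by have := @pickle_invK I k; rewrite E.
      apply/seteqP; split=> x /=; rewrite /N -ik; first by move=> ->.
      exact: (pcan_inj choice.pickleK).
    by rewrite setIC measure_label_shift// measure_label muleC.
  have -> : N @^-1` [set k] = set0.
    by apply/seteqP; split=> // x /= Nx; move: E; rewrite -Nx pickleK_inv.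
  by rewrite setI0 !measure0 mule0.
rewrite (measure_sum_fibres mG (measurable_preim_shift mA) mN).
have /fineK AE : mG A \is a fin_num by exact: fin_num_measure.
rewrite (eq_eseriesr (fun k _ => NE k)) -AE nneseriesZl// AE.
have <- : mG setT = (\sum_(k <oo) mG (N @^-1` [set k]))%E.
  by rewrite (measure_sum_fibres mG measurableT mN); apply: eq_eseriesr => k _;
    rewrite setTI.
by rewrite probability_setT mule1.
Qed.

(** On cylinders this is an induction on the length: [measure_label_shift] splits off the label at
    index 0. *)
Lemma measure_factor B : measurable B -> mG (Phi @^-1` B) = mI B.
Proof.
have [m1 m1E] := image_measure mG (measurable_factor_map phi).
rewrite -m1E; apply: path_measure_unique => [||n g].
- by rewrite m1E preimage_setT -ge0_fin_numE//; exact: fin_num_measure.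
- by rewrite -ge0_fin_numE//; exact: fin_num_measure.
rewrite m1E /= mI_markov//.
rewrite mulr1; elim: n (path_seq g) => [|n IH] {}g.
  rewrite big_ord_recl big_ord0 mulr1 -[RHS](measure_label (g 0%N)).
  congr (mG _); apply/seteqP; split=> x /=; first exact.
  by move=> xg [].
rewrite big_ord_recl EFinM -(IH (fun k => g k.+1)) -measure_label_shift//; last first.
  by apply: measurable_preim_factor; exact: measurable_cylinder.
congr (mG _); apply/seteqP; split=> x.
  by move=> xg; split; [exact: (xg 0%N)|move=> k kn; exact: (xg k.+1)].
by move=> [x0 xg] [|k] kn; [exact: x0|exact: xg].
Qed.

Lemma measure_bernoulli_shift i B : measurable B ->
  mI ([set y : Y | y 0%N = i] `&` S @^-1` B) = ((rho i)%:E * mI B)%E.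
Proof.
move=> mB; rewrite -!measure_factor//.
  rewrite -measure_label_shift; last exact: measurable_preim_factor.
  congr (mG _); apply/seteqP.
  by split=> x [xi xB]; split=> //; move: xB; rewrite /preimage/= factor_map_shift.
apply: measurableI; first exact: (measurable_coord 0 [set i]).
by rewrite -[X in measurable X]setTI; exact: measurable_markov_shift.
Qed.

(** With a single vertex every sequence of labels is a path; these maps are the inverse branches of
    [S]. *)
Definition ycons (i : I) (y : Y) : Y :=
  PathSpace (G := BG) (path_seq := fun k => if k is k'.+1 then y k' else i)
    (fun=> erefl).

Lemma shift_ycons i y : S (ycons i y) = y.
Proof. exact: path_eqP. Qed.

Lemma ycons_shift (y : Y) : ycons (y 0%N) (S y) = y.
Proof. by apply: path_eqP => -[]. Qed.

Lemma measurable_ycons i : measurable_fun setT (ycons i).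
Proof.
apply: measurable_fun_path => -[|n] g /=.
  by have [->|gi] := pselect (i = g); [rewrite (_ : mkset _ = setT)|rewrite (_ : mkset _ = set0)];
   rewrite //; apply/seteqP; split.
exact: (measurable_coord n [set g]).
Qed.

Lemma measurable_preim_ycons i B : measurable B -> measurable (ycons i @^-1` B).
Proof.
by move=> mB; rewrite -[X in measurable X]setTI; exact: measurable_ycons.
Qed.

Lemma measure_ycons i B : measurable B ->
  mI ([set y : Y | y 0%N = i] `&` B) = ((rho i)%:E * mI (ycons i @^-1` B))%E.
Proof.
move=> mB; rewrite -measure_bernoulli_shift; last exact: measurable_preim_ycons.
congr (mI _); apply/seteqP; split=> y [/= <-]; rewrite /preimage/= ycons_shift;
  by split.
Qed.

End bernoulli_factor.

(** * Subinvariant sets and functions of an ergodic map *)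

Section ergodicity.
Context {d : measure_display} {T : measurableType d} {R : realType}.
Variables (P : probability T R) (t : T -> T).
Hypothesis mt : measurable_fun setT t.
Hypothesis Pt : forall A, measurable A -> P (t @^-1` A) = P A.
Hypothesis t_ergodic : ergodic P t.

Lemma ae_iter (Q : T -> Prop) :
  (\forall x \ae P, Q x) -> \forall x \ae P, forall k, Q (iter k t x).
Proof.
move=> aeQ; apply: ae_foralln; elim=> [|k IH] //.
by apply: filterS (ae_preimage mt Pt IH) => x; rewrite iterSr.
Qed.

(** As [t] preserves [P], the inclusion of the preimage of [A] in [A] is an equality up to a null
    set. The upper limit of the iterated preimages then differs from [A] by a null set and is
    exactly invariant, as [ergodic] demands. *)
Lemma ergodic_subinvariant A : measurable A ->
  (\forall x \ae P, A (t x) -> A x) -> P A = 0%E \/ P A = 1%E.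
Proof.
move=> mA tA; have mtA : measurable (t @^-1` A).
  by rewrite -[X in measurable X]setTI; exact: mt.
have At : \forall x \ae P, A x -> A (t x).
  have /measure0_aeN : P (A `\` t @^-1` A) = 0%E.
    rewrite measureD//=; last by rewrite -ge0_fin_numE ?fin_num_measure.
    rewrite (_ : P (A `&` t @^-1` A) = P A) ?subee ?fin_num_measure//.
    rewrite -[RHS]Pt//; apply: eq_measure_ae => //; first exact: measurableI.
    by apply: filterS tA => x tA; split=> [[]|/= txA] //; split=> //; exact: tA.
  move=> /(_ (measurableD mA mtA)); apply: filterS => x nA Ax.
  by apply: contrapT => nAt; apply: nA.
have Ak : \forall x \ae P, forall k, A (iter k t x) <-> A x.
  have := ae_iter tA; have := ae_iter At.
  apply: filterS2 => x At' tA'; elim=> // k <-.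
  by split=> [/(tA' k)|/(At' k)].
pose F k := iter k t @^-1` A.
have mF k : measurable (F k).
  elim: k => [//|k IH]; rewrite /F (_ : _ @^-1` A = t @^-1` F k).
    by rewrite -[X in measurable X]setTI; exact: mt.
  by apply/seteqP; split => x; rewrite /F /preimage /mkset iterSr.
have mB : measurable (lim_sup_set F).
  by apply: bigcapT_measurable => n; exact: bigcup_measurable.
have -> : P A = P (lim_sup_set F).
  apply: eq_measure_ae => //; apply: filterS Ak => x Ak; split.
    by move=> Ax n _; exists n => //=; rewrite /F/=; apply/Ak.
  by move=> /(_ 0%N Logic.I)[k _ /Ak].
apply: t_ergodic => //; apply/seteqP; split=> x.
  by move=> + n _ => /(_ n Logic.I)[k /= nk]; rewrite /F/= -iterSr => Ak';
    exists k.+1 => //=; exact: leqW.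
move=> + n _ => /(_ n.+1 Logic.I)[[|k] //= nk]; rewrite /F/= -iterS iterSr => Ak'.
by exists k.
Qed.

(** Each set [L r] where [H] exceeds [r] is subinvariant, so it has measure 0 or 1; the constant is
    the supremum of the [r] for which it has measure 1. *)
Lemma ergodic_ae_cst (H : T -> R) (a b : R) : measurable_fun setT H ->
  (\forall x \ae P, a <= H x <= b) -> (\forall x \ae P, H (t x) <= H x) ->
  exists c, \forall x \ae P, H x = c.
Proof.
move=> mH Hab tH; pose L r := [set x | r < H x].
have mL r : measurable (L r).
  rewrite (_ : L r = H @^-1` `]r, +oo[); last first.
    by apply/seteqP; split => x; rewrite /L/= in_itv/= andbT.
  by rewrite -[X in measurable X]setTI; exact: mH.
have L01 r : P (L r) = 0%E \/ P (L r) = 1%E.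
  apply: ergodic_subinvariant => //.
  by apply: filterS tH => x tH /lt_le_trans; exact.
pose A := [set r | P (L r) = 1%E].
have A_sup : has_sup A.
  split.
    exists (a - 1); apply: ae_prob1 => //; apply: filterS Hab => x /andP[ax _].
    by rewrite /L/= (lt_le_trans _ ax)// ltrBlDr ltrDl.
  exists b => r Ar; rewrite leNgt; apply/negP => br.
  suff : P (L r) = 0%E by rewrite Ar => /eqP; rewrite eqe oner_eq0.
  apply: ae_measure0 => //; apply: filterS Hab => x /andP[_ xb].
  by apply/negP; rewrite -leNgt (le_trans xb)// ltW.
exists (sup A).
(* Thresholds at distance [k.+1%:R^-1] from the supremum keep the exceptional sets countable in
   number. *)
have le_sup : \forall x \ae P, forall k, H x <= sup A + k.+1%:R^-1.
  apply: ae_foralln => k; have [L0|L1] := L01 (sup A + k.+1%:R^-1).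
    have := measure0_aeN (mL _) L0.
    by apply: filterS => x; rewrite leNgt => /negP.
  have := ub_le_sup A_sup.2 L1.
  by rewrite leNgt ltrDl invr_gt0 ltr0n.
have ge_sup : \forall x \ae P, forall k, sup A - k.+1%:R^-1 < H x.
  apply: ae_foralln => k; have k0 : 0 < k.+1%:R^-1 :> R by rewrite invr_gt0.
  have [r Ar kr] := sup_adherent k0 A_sup.
  by apply: filterS (prob1_ae (mL r) Ar) => x; exact: lt_trans.
apply: filterS2 le_sup ge_sup => x xle xge; apply/eqP; rewrite eq_le.
apply/andP; split; rewrite leNgt; apply/negP => /ltr_add_invr[k kx].
  by have := xle k; rewrite leNgt kx.
by have := xge k; rewrite ltrBlDr ltNge ltW.
Qed.

End ergodicity.

(** * Densities with respect to a probability *)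

Section density_complements.
Context {d : measure_display} {T : measurableType d} {R : realType}.
Variable P : probability T R.

(** The function [g - a] is positive on [B], but its integral over [B] is at most 0. *)
Lemma integral_gt_null (g : T -> R) (B : set T) (a : R) :
  measurable_fun setT g -> measurable B -> 0 <= a ->
  (forall y, B y -> a < g y) ->
  (\int[P]_(y in B) (g y)%:E <= a%:E * P B)%E -> P B = 0%E.
Proof.
move=> mg mB a0 ag le_int; have mgB : measurable_fun B g by exact: measurable_funTS.
pose h y : R := g y - a.
have mh : measurable_fun B (EFin \o h).
  by apply/measurable_EFinP; exact: measurable_funB.
have h0 y : B y -> (0 <= (h y)%:E)%E.
  by move=> By; rewrite lee_fin subr_ge0 ltW// ag.
have int0 : (\int[P]_(y in B) `|(h y)%:E| = 0)%E.
  under eq_integral => y /[!inE] By do rewrite gee0_abs ?h0//.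
  apply/eqP; rewrite eq_le integral_ge0// andbT.
  have : (\int[P]_(y in B) ((h y)%:E + a%:E) <= a%:E * P B)%E.
    by under eq_integral do rewrite -EFinD subrK.
  rewrite ge0_integralD//.
  rewrite integral_cst//; rewrite -[leRHS]add0e leeD2rE//.
  by rewrite fin_numM// fin_num_measure.
have /ae_eq_integral_abs -/(_ mB) := int0.
move=> /(_ mh) ae0; apply: ae_measure0 => //; apply: filterS ae0 => y /[swap] By.
by move=> /(_ By) [] /eqP; rewrite subr_eq0 => /eqP gya; have := ag _ By; rewrite gya ltxx.
Qed.

Lemma radon_nikodym_le (nu : {measure set T -> \bar R}) :
  (forall A, measurable A -> (nu A <= P A)%E) ->
  exists g : T -> R, [/\ measurable_fun setT g, forall y, 0 <= g y &
    forall B, measurable B -> nu B = (\int[P]_(y in B) (g y)%:E)%E].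
Proof.
move=> nuP.
have nuT_oo : (nu setT < +oo)%E.
  by rewrite (le_lt_trans (nuP _ measurableT))// probability_setT ltry.
pose nuM : {finite_measure set T -> \bar R} := mfrestr measurableT nuT_oo.
have nuME A : nuM A = nu A by rewrite /nuM/= /mfrestr /mrestr setIT.
have nuP0 : nuM `<< P.
  apply/null_content_dominatesP => A mA PA; apply/eqP.
  by rewrite eq_le measure_ge0 andbT nuME -PA; exact: nuP.
have [g [g0 gfin gint gE]] := radon_nikodym_sigma_finite nuP0.
exists (fine \o g); split.
- apply: measurableT_comp; first exact: fine_measurable.
  by have /integrableP[] := gint.
- by move=> y; exact: fine_ge0.
- move=> B mB; rewrite -nuME gE//.
  by apply: eq_integral => y _; rewrite /= fineK.
Qed.

End density_complements.

(* Series over a countable type are indexed by the codes of its elements. *)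
Lemma card_of_sum (R : realType) (U : countType) (C : set U) (c : R) : 0 < c ->
  (\sum_(n <oo) (if pickle_inv n is Some u then c * (u \in C)%:R else 0)%:E = 1)%E ->
  finite_set C /\ c * #|` fset_set C|%:R = 1.
Proof.
move=> c0; pose D := [set choice.pickle u | u in C].
have CD : (D #= C)%card.
  by apply: inj_card_eq => u v _ _; exact: (pcan_inj choice.pickleK).
(* The series is [c] times the counting measure of the codes of [C]; its finite value excludes an
   infinite [C]. *)
rewrite (_ : (\sum_(n <oo) _)%E = (c%:E * counting D)%E); last first.
  rewrite counting_dirac -nneseriesZl//; apply: eq_eseriesr => n _.
  rewrite diracE; case E : pickle_inv => [u|].
    have un : choice.pickle u = n by have := @pickle_invK U n; rewrite E.
    rewrite -EFinM; congr (c * (nat_of_bool _)%:R)%:E.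
    apply/idP/idP; rewrite !inE /D; first by exists u.
    by move=> [v Cv]; rewrite -un => /(pcan_inj choice.pickleK) <-.
  rewrite memNset ?mule0//.
  by move=> [u _ un]; move: E; rewrite -un pickleK_inv.
rewrite /counting; case: asboolP => [finD|_]; last first.
  by rewrite gt0_muley// => /eqP.
have finC : finite_set C by move: finD; rewrite (eq_finite_set CD).
by rewrite (elimT (fcard_eq finD finC) CD) => -[E]; split.
Qed.

(** * Conditional probabilities of the end vertex *)

Section conditional_structure.
Variables (R : realType) (G : stochGraph R) (I : countType) (rho : I -> R).
Variables (rho_gt0 : forall i, 0 < rho i).
Variables (rho_sum1 : (\esum_(i in [set: I]) (rho i)%:E = 1)%E).
Local Notation BG := (bernoulli_graph rho_gt0 rho_sum1).
Variable phi : graph_hom G BG.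
Variable mG : probability (path_space G) R.
Hypothesis mG_markov : is_markov_measure mG.
Variable mI : probability (path_space BG) R.
Hypothesis mI_markov : is_markov_measure mI.

Local Notation X := (path_space G).
Local Notation Y := (path_space BG).
Local Notation T := (@markov_shift R G).
Local Notation S := (@markov_shift R BG).
Local Notation Phi := (factor_map phi).
Local Notation f := (vertex_map phi).

Hypothesis TG_ergodic : ergodic mG T.

Lemma ae_factor (Q : Y -> Prop) :
  (\forall y \ae mI, Q y) -> \forall x \ae mG, Q (Phi x).
Proof.
exact: (ae_preimage (measurable_factor_map phi)
  (measure_factor phi mG_markov mI_markov)).
Qed.

Lemma ae_shift (Q : X -> Prop) :
  (\forall x \ae mG, Q x) -> \forall x \ae mG, Q (T x).
Proof.
exact: (ae_preimage (@measurable_markov_shift R G) (measure_shift phi mG_markov)).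
Qed.

(** [g y] is a version of the conditional probability of [start x = u] given [Phi x = y]. *)
Definition is_density (u : vertex G) (g : Y -> R) :=
  [/\ measurable_fun setT g, forall y, 0 <= g y &
    forall B, measurable B -> mG ([set x | start x = u] `&` Phi @^-1` B) =
      (\int[mI]_(y in B) (g y)%:E)%E].

Lemma density_ex u : exists g, is_density u g.
Proof.
have mu := measurable_start (G := G) [set u].
have [nu nuE] := image_measure (mrestr mG mu) (measurable_factor_map phi).
have nuE' B : nu B = mG ([set x | start x = u] `&` Phi @^-1` B).
  by rewrite nuE setIC.
have [|g [mg g0 gE]] := @radon_nikodym_le _ _ _ mI nu.
  move=> B mB; rewrite nuE' -(measure_factor phi mG_markov mI_markov)//.
  apply: le_measure; rewrite ?inE//.
    by apply: measurableI => //; exact: measurable_preim_factor.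
  exact: measurable_preim_factor.
by exists g; split=> // B mB; rewrite -nuE' gE.
Qed.

Variable h : vertex G -> Y -> R.
Hypothesis h_density : forall u, is_density u (h u).

Let mh u : measurable_fun setT (h u). Proof. by have [] := h_density u. Qed.
Let h_ge0 u y : 0 <= h u y. Proof. by have [_ ->] := h_density u. Qed.
Let hE u B : measurable B -> mG ([set x | start x = u] `&` Phi @^-1` B) =
  (\int[mI]_(y in B) (h u y)%:E)%E.
Proof. by have [_ _] := h_density u; apply. Qed.

Let mhpre u A : measurable A -> measurable (h u @^-1` A).
Proof. by move=> mA; rewrite -[X in measurable X]setTI; exact: mh. Qed.

Let measurable_gt u a : measurable [set y | a < h u y].
Proof.
rewrite (_ : [set y | _] = h u @^-1` `]a, +oo[); first exact: mhpre.
by apply/seteqP; split => x /=; rewrite in_itv/= andbT.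
Qed.

Let measurable_le u a : measurable [set y | h u y <= a].
Proof.
rewrite (_ : [set y | _] = h u @^-1` `]-oo, a]); first exact: mhpre.
by apply/seteqP; split => x /=; rewrite in_itv/=.
Qed.

Let density_le1 u : \forall y \ae mI, h u y <= 1.
Proof.
have m1 := measurable_gt u 1; suff /measure0_aeN : mI [set y | 1 < h u y] = 0%E.
  by move=> /(_ m1); apply: filterS => y /negP; rewrite -leNgt.
apply: (integral_gt_null (mh u) m1 ler01) => //.
rewrite -hE// mul1e -(measure_factor phi mG_markov mI_markov)//.
apply: le_measure; rewrite ?inE//.
  by apply: measurableI; [exact: (measurable_start [set u])|exact: measurable_preim_factor].
exact: measurable_preim_factor.
Qed.

(** A path ending at [v] and extended by the label [i] ends at [f i v], so conditional probability
    can only be gained; [N] collects the exceptions. *)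
Let density_step_gt i v (a : R) : 0 <= a ->
  \forall y \ae mI, (y : Y) 0%N = i -> a < h v (S y) -> a < h (f i v) y.
Proof.
move=> a0; set u := f i v.
pose N := [set y : Y | y 0%N = i] `&`
  (S @^-1` [set y | a < h v y] `&` [set y | h u y <= a]).
have mN : measurable N.
  apply: measurableI; first exact: (measurable_coord 0 [set i]).
  apply: measurableI; last exact: measurable_le.
  by rewrite -[X in measurable X]setTI; exact: measurable_markov_shift.
(* [N'] is [N] with the label at index 0 removed; by independence [mI N] is [rho i] times
   [mI N']. *)
pose N' := ycons i @^-1` N.
have mN' : measurable N' by exact: measurable_preim_ycons.
have NN' : N = [set y : Y | y 0%N = i] `&` S @^-1` N'.
  apply/seteqP; split=> y.
    move=> Ny; split; first by case: Ny.
    by rewrite /N' /preimage /mkset; have [/= <- _] := Ny; rewrite ycons_shift.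
  by move=> [/= yi]; rewrite /N' /preimage /mkset -{1}yi ycons_shift.
(* [h v > a] on [N'], whereas the step [i] bounds the integral of [h v] over
   [N'] by [a * mI N'], since it maps [v] to [u] and [h u <= a] on [N]. *)
have N0 : mI N = 0%E.
  rewrite NN' (measure_bernoulli_shift phi mG_markov)//.
  suff -> : mI N' = 0%E by rewrite mule0.
  apply: (integral_gt_null (mh v) mN' a0) => [y [_ []] /=|].
    by rewrite shift_ycons.
  rewrite -hE// -(@lee_pmul2l _ (rho i)%:E)//; last by rewrite lte_fin.
  rewrite -(measure_label_shift phi mG_markov); last first.
    apply: measurableI; first exact: (measurable_start [set v]).
    exact: measurable_preim_factor.
  rewrite muleCA -(measure_bernoulli_shift phi mG_markov mI_markov)// -NN'.
  apply: (@le_trans _ _ (mG ([set x | start x = u] `&` Phi @^-1` N))).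
    apply: le_measure; rewrite ?inE.
    - apply: measurableI; first exact: measurable_label.
      apply: measurable_preim_shift; apply: measurableI.
        exact: (measurable_start [set v]).
      exact: measurable_preim_factor.
    - apply: measurableI; first exact: (measurable_start [set u]).
      exact: measurable_preim_factor.
    - move=> x [xi [/= xv xN']]; split; first by rewrite /= -(start_shift phi) xi xv.
      by rewrite NN'; split=> //; move: xN'; rewrite /preimage/= factor_map_shift.
  rewrite hE// -integral_cst//; apply: ge0_le_integral => //.
  - by move=> y _; rewrite lee_fin.
  - by apply/measurable_EFinP; exact: measurable_funTS.
  - by move=> y [_ [_]]; rewrite lee_fin.
apply: filterS (measure0_aeN mN N0) => y nN yi av; rewrite ltNge.
by apply/negP => ua; apply: nN.
Qed.

(** Rational thresholds, labels and vertices are countably many, so one null set serves for all; a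
    strict reverse inequality would leave room for a rational. *)
Let density_step : \forall y \ae mI, forall v, h v (S y) <= h (f ((y : Y) 0%N) v) y.
Proof.
have : \forall y \ae mI, forall (q : rat) (i : I) (v : vertex G),
    0 <= ratr q :> R -> (y : Y) 0%N = i -> ratr q < h v (S y) -> ratr q < h (f i v) y.
  apply: ae_forall_countType => q; apply: ae_forall_countType => i.
  apply: ae_forall_countType => v.
  have [q0|q0] := pselect (0 <= ratr q :> R); last by apply: aeW => y /q0.
  by apply: filterS (density_step_gt i v q0) => y yE _.
apply: filterS => y hy v; rewrite leNgt; apply/negP => /rat_in_itvoo[q].
rewrite in_itv/= => /andP[q1 q2].
have := hy q _ v (le_trans (h_ge0 _ _) (ltW q1)) erefl q2.
by rewrite ltNge ltW.
Qed.

Definition density_along x := h (start x) (Phi x).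

Let measurable_density_along : measurable_fun setT density_along.
Proof.
move=> _ A mA; rewrite setTI.
rewrite (_ : _ @^-1` A =
    \bigcup_u ([set x | start x = u] `&` Phi @^-1` (h u @^-1` A))).
  apply: measurable_bigcup_countType => u; apply: measurableI.
    exact: (measurable_start [set u]).
  by apply: measurable_preim_factor; exact: mhpre.
apply/seteqP; split=> x; first by move=> Ax; exists (start x).
by move=> [u _ [/= <-]].
Qed.

(** [density_step] at the vertex [start (T x)] says that [density_along] does not increase under
    [T]. *)
Lemma density_along_cst :
  exists2 c : R, 0 < c & \forall x \ae mG, h (start x) (Phi x) = c.
Proof.
have [|||c Hc] := @ergodic_ae_cst _ _ _ mG T (@measurable_markov_shift R G)
    (measure_shift phi mG_markov) TG_ergodic density_along 0 1.
- exact: measurable_density_along.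
- have : \forall y \ae mI, forall u, h u y <= 1.
    exact: ae_forall_countType density_le1.
  by move=> /ae_factor; apply: filterS => x h1; rewrite h_ge0 h1.
- move: density_step => /ae_factor; apply: filterS => x /(_ (start (T x))).
  by rewrite /density_along factor_map_shift (start_shift phi).
exists c => //; rewrite ltNge; apply/negP => c0.
(* Positivity of [c]: almost no path ends at a vertex of conditional probability 0, since [h u]
   integrates to 0 over the set where it vanishes. *)
have : \forall x \ae mG, forall u, ~ (start x = u /\ h u (Phi x) <= 0).
  apply: ae_forall_countType => u.
  pose B := [set x | start x = u] `&` Phi @^-1` [set y | h u y <= 0].
  have mB : measurable B.
    apply: measurableI; first exact: (measurable_start [set u]).
    exact: measurable_preim_factor.
  suff B0 : mG B = 0%E by exact: (measure0_aeN mB B0).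
  rewrite hE//; apply: integral0_eq => y /= hy0; apply/eqP; rewrite eqe eq_le hy0.
  exact: h_ge0.
move=> H0.
have : mG set0 = 1%E.
  apply: ae_prob1 => //; apply: filterS2 Hc H0 => x xc /(_ (start x)); apply.
  by split=> //; rewrite -[h _ _]/(density_along x) xc.
by rewrite measure0 => /eqP; rewrite eqe eq_sym oner_eq0.
Qed.

(** The integral of [h u] over the set where it is positive and differs from [c] is the mass of
    paths ending at [u] on which the constant is missed, hence 0. *)
Lemma density_two_valued c : (\forall x \ae mG, h (start x) (Phi x) = c) ->
  \forall y \ae mI, forall u, h u y = 0 \/ h u y = c.
Proof.
move=> Hc; apply: ae_forall_countType => u.
pose B := [set y | 0 < h u y] `&` ~` (h u @^-1` [set c]).
have mB : measurable B.
  by apply: measurableI => //; apply: measurableC; exact: mhpre.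
have B0 : mI B = 0%E.
  apply: (integral_gt_null (mh u) mB (lexx 0)) => [y []//|].
  rewrite -hE// mul0e (_ : mG _ = 0%E)//; apply: ae_measure0.
    apply: measurableI; first exact: (measurable_start [set u]).
    exact: measurable_preim_factor.
  by apply: filterS Hc => x xc [/= xu [_]]; rewrite /= -xu.
apply: filterS (measure0_aeN mB B0) => y nB.
have [->|hc] := eqVneq (h u y) c; [by right|left].
apply/eqP; rewrite eq_le h_ge0 andbT leNgt; apply/negP => h_gt0.
by apply: nB; split=> //; exact/eqP.
Qed.

(** Every path ends at exactly one vertex, so the sum has integral [mI E] over each measurable
    [E]. *)
Lemma density_sum : \forall y \ae mI,
  (\sum_(n <oo) (if pickle_inv n is Some u then h u y else 0)%:E = 1)%E.
Proof.
pose g n y : \bar R := (if pickle_inv n is Some u then h u y else 0)%:E.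
have mg n : measurable_fun setT (g n).
  rewrite /g; case: pickle_inv => [u|]; last exact: measurable_cst.
  exact/measurable_EFinP.
have g0 n y : (0 <= g n y)%E by rewrite /g; case: pickle_inv => [u|]; rewrite lee_fin.
have : ae_eq mI setT (cst 1%E) (fun y => \sum_(n <oo) g n y)%E.
  apply: integral_ae_eq => //.
  - exact: finite_measure_integrable_cst.
  - by apply: ge0_emeasurable_sum.
  move=> E _ mE; rewrite integral_cst// mul1e integral_nneseries//; last first.
    by move=> n; exact: measurable_funTS.
  rewrite -[LHS]/(mI E) -(measure_factor phi mG_markov mI_markov)//.
  pose N (x : X) := choice.pickle (start x).
  have mN k : measurable (N @^-1` [set k]).
    exact: (measurable_start [set u | choice.pickle u = k]).
  rewrite (measure_sum_fibres mG (measurable_preim_factor phi mE) mN).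
  apply: eq_eseriesr => n _; rewrite /g.
  case En : pickle_inv => [u|].
    rewrite -hE// setIC; congr (mG (_ `&` _)).
    have un : choice.pickle u = n by have := @pickle_invK (vertex G) n; rewrite En.
    apply/seteqP; split=> x /=; rewrite /N -un; last by move=> ->.
    exact: (pcan_inj choice.pickleK).
  rewrite integral0 (_ : N @^-1` _ = set0) ?setI0 ?measure0//.
  by apply/seteqP; split=> // x /= Nx; move: En; rewrite -Nx pickleK_inv.
by apply: filterS => y /(_ Logic.I) /= <-.
Qed.

End conditional_structure.

(** * The finite set of vertices that carries a fibre *)

Section fibre_vertices.
Variables (R : realType) (G : stochGraph R) (I : countType) (rho : I -> R).
Variables (rho_gt0 : forall i, 0 < rho i).
Variables (rho_sum1 : (\esum_(i in [set: I]) (rho i)%:E = 1)%E).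
Local Notation BG := (bernoulli_graph rho_gt0 rho_sum1).
Variable phi : graph_hom G BG.
Variable mG : probability (path_space G) R.
Hypothesis mG_markov : is_markov_measure mG.
Variable mI : probability (path_space BG) R.
Hypothesis mI_markov : is_markov_measure mI.

Local Notation X := (path_space G).
Local Notation Y := (path_space BG).
Local Notation T := (@markov_shift R G).
Local Notation S := (@markov_shift R BG).
Local Notation Phi := (factor_map phi).
Local Notation f := (vertex_map phi).

Hypothesis TG_ergodic : ergodic mG T.

Lemma measure_shift_bernoulli B : measurable B -> mI (S @^-1` B) = mI B.
Proof.
move=> mB; have mSB : measurable (S @^-1` B).
  by rewrite -[X in measurable X]setTI; exact: measurable_markov_shift.
have mPB := measurable_preim_factor phi mB.
rewrite -!(measure_factor phi mG_markov mI_markov)//.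
rewrite -[RHS](measure_shift phi mG_markov)//; congr (mG _).
by apply/seteqP; split=> x; rewrite /preimage /mkset factor_map_shift.
Qed.

Lemma fibre_vertices_ex : exists (C : Y -> {fset vertex G}) (d : nat),
  [/\ (0 < d)%N,
    forall u, measurable [set y | u \in C y],
    forall u B, measurable B -> mG ([set x | start x = u] `&` Phi @^-1` B) =
      ((d%:R^-1)%:E * mI (B `&` [set y | u \in C y]))%E,
    \forall x \ae mG, start x \in C (Phi x) &
    \forall y \ae mI, #|` C y| = d /\
      C y = [fset f ((y : Y) 0%N) v | v in C (S y)]%fset].
Proof.
have [h hP] := choice (density_ex phi mG_markov mI_markov).
have [c c0 Hc] := density_along_cst mG_markov mI_markov TG_ergodic hP.
have h2 := density_two_valued hP Hc.
have hs := density_sum mG_markov mI_markov hP.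
have := filterI h2 hs; move=> [N [mN N0 hN]].
pose Cs y := [set u | h u y = c].
have CsP y : ~ N y -> finite_set (Cs y) /\ c * #|` fset_set (Cs y)|%:R = 1.
  move=> nNy; have [{}h2 {}hs] : (forall u, h u y = 0 \/ h u y = c) /\
      (\sum_(n <oo) (if pickle_inv n is Some u then h u y else 0)%:E = 1)%E.
    by apply: contrapT => nh; apply: nNy; exact: hN.
  apply: card_of_sum => //; rewrite -[RHS]hs; apply: eq_eseriesr => n _.
  case: pickle_inv => // u; congr _%:E.
  have [huc|huc] := eqVneq (h u y) c; first by rewrite huc mem_set ?mulr1.
  rewrite memNset ?mulr0; first by have [->//|/eqP] := h2 u; rewrite (negbTE huc).
  by move=> /eqP; exact/negP.
(* The value [fset0] on the null set [N] keeps [u \in C y] measurable in [y]. *)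
pose C y := if y \in N then fset0 else fset_set (Cs y).
have CN y u : ~ N y -> (u \in C y) = (h u y == c).
  move=> nNy; rewrite /C memNset// in_fset_set; last by have [] := CsP _ nNy.
  by apply/idP/eqP; rewrite inE.
(* [d] is read off at one point outside the null set; off [N] the cardinality times [c] is 1, so it
   is the same everywhere. *)
have [y0 nNy0] : exists y0, ~ N y0.
  apply: contrapT => /forallNP nN; have : mI N = 1%E.
    by apply: ae_prob1 => //; apply: aeW => y; exact: contrapT.
  by rewrite N0 => /eqP; rewrite eqe eq_sym oner_eq0.
pose d := #|` C y0|.
have dE : c * d%:R = 1 by have [_] := CsP _ nNy0; rewrite /d /C memNset.
have d0 : d%:R != 0 :> R.
  by apply/negP => /eqP d0; move: dE; rewrite d0 mulr0 => /eqP; rewrite eq_sym oner_eq0.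
have cE : c = d%:R^-1 by apply: (mulIf d0); rewrite dE mulVf.
have Cd y : ~ N y -> #|` C y| = d.
  move=> nNy; have [_ cn] := CsP _ nNy.
  have : c * #|` fset_set (Cs y)|%:R = c * d%:R by rewrite cn dE.
  by move=> /(mulfI (lt0r_neq0 c0))/eqP; rewrite eqr_nat /C memNset// => /eqP.
have aeN : \forall y \ae mI, ~ N y by exact: measure0_aeN.
have mC u : measurable [set y | u \in C y].
  rewrite (_ : mkset _ = ~` N `&` (h u @^-1` [set c])).
    apply: measurableI; first exact: measurableC.
    by rewrite -[X in measurable X]setTI; have [+ _ _] := hP u; apply.
  apply/seteqP; split=> y /=; last by move=> [nNy /eqP]; rewrite CN.
  rewrite /C; case: ifPn => // /negP yN; have nNy : ~ N y by move=> /mem_set.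
  by move=> uC; split=> //; apply/eqP; rewrite -CN// /C memNset.
have CE u B : measurable B -> mG ([set x | start x = u] `&` Phi @^-1` B) =
    ((d%:R^-1)%:E * mI (B `&` [set y | u \in C y]))%E.
  move=> mB; have [mh h0 hE] := hP u; rewrite hE// -cE.
  have mind : measurable_fun B (fun y => (\1_[set y | u \in C y] y)%:E : \bar R).
    apply/measurable_EFinP; apply: measurable_funTS.
    exact: measurable_indic.
  rewrite setIC -integral_indic// -ge0_integralZl_EFin//; last exact: ltW.
  apply: ge0_ae_eq_integral => //.
  - by apply/measurable_EFinP; exact: measurable_funTS.
  - exact: emeasurable_funM.
  - by move=> y _; rewrite lee_fin.
  - by move=> y _; rewrite mule_ge0// lee_fin// ltW.
  apply: filterS2 aeN h2 => y nNy /(_ u) h2 _; rewrite -EFinM; congr _%:E.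
  rewrite indicE; have [huc|huc] := eqVneq (h u y) c.
    by rewrite mem_set ?mulr1//= CN// huc.
  rewrite memNset ?mulr0; first by case: h2 => [//|/eqP]; rewrite (negbTE huc).
  by rewrite /= CN//; exact/negP.
have startC : \forall x \ae mG, start x \in C (Phi x).
  have := ae_factor phi mG_markov mI_markov aeN.
  by apply: filterS2 Hc => x xc nN; rewrite CN// xc.
exists C, d; split=> //; first by rewrite lt0n -(eqr_nat R).
(* For almost every path, [start (T x)] lies in [C (S y)] and is mapped to [start x]. So almost no
   path ends at a [u] without such a [v], and by [CE] the [y] with such a [u] in [C y] form a null
   set. *)
have pre : \forall y \ae mI, forall u, u \in C y ->
    exists2 v, v \in C (S y) & f ((y : Y) 0%N) v = u.
  apply: ae_forall_countType => u.
  pose E := \bigcup_v ([set y : Y | f (y 0%N) v = u] `&`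
    S @^-1` [set y | v \in C y]).
  have mE : measurable E.
    apply: measurable_bigcup_countType => v; apply: measurableI.
      exact: (measurable_coord (G := BG) 0 (fun i => f i v = u)).
    by rewrite -[X in measurable X]setTI; exact: measurable_markov_shift.
  have := CE u (~` E) (measurableC mE).
  rewrite (_ : mG _ = 0%E); last first.
    apply: ae_measure0.
      apply: measurableI; first exact: (measurable_start [set u]).
      by apply: measurable_preim_factor; exact: measurableC.
    have := ae_shift phi mG_markov startC.
    apply: filterS => x xC [/= xu]; apply; exists (start (T x)) => //; split.
      by rewrite -xu; exact: start_shift.
    by rewrite /preimage /mkset -factor_map_shift.
  move=> /esym/eqP; rewrite mule_eq0 eqe invr_eq0 (negbTE d0)/= => /eqP.
  have mB : measurable (~` E `&` [set y | u \in C y]).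
    by apply: measurableI => //; exact: measurableC.
  move=> /(measure0_aeN mB); apply: filterS => y nE uC.
  apply: contrapT => nv; apply: nE; split=> // -[v _ [vu vC]].
  by apply: nv; exists v.
have aeSN : \forall y \ae mI, ~ N (S y).
  exact: ae_preimage (@measurable_markov_shift R BG) measure_shift_bernoulli _ aeN.
apply: filterS3 pre aeN aeSN => y yC nNy nNSy; split; first exact: Cd.
(* The image of [C (S y)] contains [C y] by [pre] and has at most [d] elements, the number that
   [C y] has. *)
apply/eqP; rewrite eqEfcard; apply/andP; split.
  by apply/fsubsetP => u /yC[v vC <-]; apply/imfsetP; exists v.
by rewrite (leq_trans (leq_imfset_card _ _ _))// -/(#|` _|) Cd//; have := Cd _ nNSy => /= ->.
Qed.

End fibre_vertices.

(** * The conditional measures on the fibres *)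

Section prob_kernel_of.
Context {d d' : measure_display} {Y : measurableType d} {X : measurableType d'}.
Context {R : realType}.
Variable m : Y -> {measure set X -> \bar R}.
Hypothesis mm : forall A, measurable A -> measurable_fun setT (m ^~ A).
Hypothesis m1 : forall y, m y setT = 1%E.

(* The proofs are arguments only to attach the kernel instances to the constant. *)
Definition prob_kernel_of & (forall A, measurable A -> measurable_fun setT (m ^~ A))
  & (forall y, m y setT = 1%E) := m.

HB.instance Definition _ := isKernel.Build _ _ _ _ _ (prob_kernel_of mm m1) mm.
HB.instance Definition _ :=
  Kernel_isProbability.Build _ _ _ _ _ (prob_kernel_of mm m1) m1.

Lemma prob_kernel_ex : exists k : R.-pker Y ~> X, forall y A, k y A = m y A.
Proof. by exists (prob_kernel_of mm m1). Qed.

End prob_kernel_of.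

(** Meant for [L = C y], which varies with [y]: the index set of the series is fixed, so
    measurability and integrals can be treated term by term. *)
Lemma series_fset (R : realType) (U : countType) (L : {fset U}) (a : U -> R) :
  (forall u, 0 <= a u) ->
  (\sum_(n <oo) (if pickle_inv n is Some u then a u * (u \in L)%:R else 0)%:E =
   (\sum_(u <- L) a u)%:E)%E.
Proof.
move=> a0.
have dE n v : (if pickle_inv n is Some u then a u * (u == v)%:R else 0)%:E =
    ((a v)%:E * \d_n [set choice.pickle v])%E.
  rewrite diracE -EFinM; congr _%:E; case E : pickle_inv => [u|].
    have un : choice.pickle u = n by have := @pickle_invK U n; rewrite E.
    have [uv|uv] := eqVneq u v; first by rewrite -uv un mem_set.
    rewrite memNset ?mulr0//= -un => /(pcan_inj choice.pickleK) /eqP.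
    by rewrite (negbTE uv).
  by rewrite memNset ?mulr0//= => nv; move: E; rewrite nv pickleK_inv.
transitivity (\sum_(n <oo) \sum_(v <- L)
    (if pickle_inv n is Some u then a u * (u == v)%:R else 0)%:E)%E.
  apply: eq_eseriesr => n _; rewrite sumEFin; congr _%:E.
  case: pickle_inv => [u|]; last by rewrite big1.
  rewrite -mulr_sumr; congr (_ * _).
  case: (boolP (u \in L)) => uL.
    rewrite (big_fsetD1 u)//= eqxx big_seq big1 ?addr0// => v.
    by rewrite !inE => /andP[vu _]; rewrite eq_sym (negbTE vu).
  rewrite big_seq big1// => v vL; case: eqVneq => // uv.
  by move: uL; rewrite uv vL.
rewrite nneseries_sum; last first.
  by move=> v n _; case: pickle_inv => // u; rewrite lee_fin mulr_ge0.
rewrite -sumEFin; apply: eq_bigr => v _; under eq_eseriesr do rewrite dE.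
rewrite nneseriesZl// -counting_dirac /counting.
case: asboolP => [_|[]]; last exact: finite_set1.
by rewrite fset_set1 cardfs1 mule1.
Qed.

Lemma imfset_card_inj (K K' : choiceType) (g : K -> K') (A : {fset K}) :
  #|` [fset g x | x in A]%fset| = #|` A| -> {in A &, injective g}.
Proof.
move=> gA u v uA vA guv; apply/eqP; apply: contraT => uv.
suff : (#|` [fset g x | x in A]%fset| < #|` A|)%N by rewrite gA ltnn.
rewrite [X in (_ < X)%N](cardfsD1 u) uA add1n ltnS.
apply: leq_trans (leq_imfset_card imfset_key g (mem (A `\ u)%fset)).
apply: fsubset_leq_card; apply/fsubsetP => _ /imfsetP[w /= wA ->].
have [wu|wu] := eqVneq w u; apply/imfsetP.
  by exists v => //=; [rewrite !inE eq_sym uv|rewrite wu].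
by exists w; rewrite //= !inE wu.
Qed.

(** * Lifts of a label sequence and the uniform measure on them *)

Section fibre_measure.
Variables (R : realType) (G : stochGraph R) (I : countType) (rho : I -> R).
Variables (rho_gt0 : forall i, 0 < rho i).
Variables (rho_sum1 : (\esum_(i in [set: I]) (rho i)%:E = 1)%E).
Local Notation BG := (bernoulli_graph rho_gt0 rho_sum1).
Variable phi : graph_hom G BG.
Variable mG : probability (path_space G) R.
Hypothesis mG_markov : is_markov_measure mG.
Variable mI : probability (path_space BG) R.
Hypothesis mI_markov : is_markov_measure mI.

Local Notation X := (path_space G).
Local Notation Y := (path_space BG).
Local Notation T := (@markov_shift R G).
Local Notation S := (@markov_shift R BG).
Local Notation Phi := (factor_map phi).
Local Notation f := (vertex_map phi).

Variables (C : Y -> {fset vertex G}) (d : nat) (N : set Y).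
Hypothesis d_gt0 : (0 < d)%N.
Hypothesis mC : forall u, measurable [set y | u \in C y].
Hypothesis CE : forall u B, measurable B ->
  mG ([set x | start x = u] `&` Phi @^-1` B) =
    ((d%:R^-1)%:E * mI (B `&` [set y | u \in C y]))%E.
Hypothesis startC : \forall x \ae mG, start x \in C (Phi x).
Hypothesis mN : measurable N.
Hypothesis N0 : mI N = 0%E.
Hypothesis CN : forall y n, ~ N y -> #|` C (iter n S y)| = d /\
  C (iter n S y) = [fset f ((y : Y) n) v | v in C (iter n.+1 S y)]%fset.

Let C_inj y n : ~ N y -> {in C (iter n.+1 S y) &, injective (f (y n))}.
Proof.
move=> nN; apply: imfset_card_inj.
by have [dE <-] := CN n nN; have [-> _] := CN n.+1 nN.
Qed.

Let C_pre y n u : ~ N y -> u \in C (iter n S y) ->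
  exists2 v, v \in C (iter n.+1 S y) & f (y n) v = u.
Proof.
by move=> nN; have [_ ->] := CN n nN => /imfsetP[v vC ->]; exists v.
Qed.

Let C_step y n v : ~ N y -> v \in C (iter n.+1 S y) -> f (y n) v \in C (iter n S y).
Proof. by move=> nN vC; have [_ ->] := CN n nN; apply/imfsetP; exists v. Qed.

(** The head of [w] is the last label in time and is applied last. *)
Definition word_map (w : seq I) (v : vertex G) := foldr f v w.

Lemma path_prefixS (H : stochGraph R) (x : path_space H) n :
  path_prefix n.+1 x = rcons (path_prefix n x) (x n).
Proof. exact: (mkseqS x n). Qed.

Lemma word_mapS (y : Y) n v :
  word_map (path_prefix n.+1 y) v = word_map (path_prefix n y) (f (y n) v).
Proof. by rewrite path_prefixS /word_map -cats1 foldr_cat. Qed.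

Lemma start_word_map (x : X) n :
  word_map (path_prefix n (Phi x)) (trm G (x n)) = start x.
Proof.
elim: n => [|n IH] //; rewrite word_mapS -IH; congr (word_map _ _).
by rewrite -path_adj; exact: vertex_map_src.
Qed.

Let C_word_inj y n : ~ N y ->
  {in C (iter n S y) &, injective (word_map (path_prefix n y))}.
Proof.
move=> nN; elim: n => [|n IH] u v uC vC //; rewrite !word_mapS.
by move=> /IH E; apply: (C_inj nN uC vC); apply: E; exact: C_step.
Qed.

(** Keeping only paths through the sets [C (iter n S y)] makes the end vertex determine the path, as
    the vertex maps are injective between these sets. *)
Definition lifts y u (x : X) :=
  [/\ Phi x = y, start x = u & forall n, trm G (x n) \in C (iter n S y)].

(** Each [f (y n)] maps [C (iter n.+1 S y)] onto [C (iter n S y)], so the vertices are chosen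
    backwards in time, starting from [u]. *)
Lemma lifts_ex y u : ~ N y -> u \in C y -> exists x, lifts y u x.
Proof.
move=> nN uC.
pose next n v := xget v [set w | w \in C (iter n.+1 S y) /\ f (y n) w = v].
have nextP n v : v \in C (iter n S y) ->
    next n v \in C (iter n.+1 S y) /\ f (y n) (next n v) = v.
  move=> /(C_pre nN)[w wC wv]; rewrite /next.
  by apply: (@xgetPex _ v [set w | w \in _ /\ _]); exists w.
pose v_ := nat_rect (fun=> vertex G) u next.
have vC n : v_ n \in C (iter n S y).
  by elim: n => [//|n IH]; rewrite -[v_ _]/(next n (v_ n)); have [] := nextP _ _ IH.
have vE n : f (y n) (v_ n.+1) = v_ n by have [] := nextP _ _ (vC n).
have adj n : src G (lift_edge phi (y n) (v_ n.+1)) =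
    trm G (lift_edge phi (y n.+1) (v_ n.+2)).
  by rewrite src_lift_edge -[RHS]/(f (y n.+1) (v_ n.+2)) vE.
exists (PathSpace adj); split.
- by apply: path_eqP => n /=; rewrite hom_lift_edge.
- exact: (vE 0%N).
- by move=> n; rewrite -[trm _ _]/(f (y n) (v_ n.+1)) vE.
Qed.

(** The right side no longer mentions [x] and is a measurable condition on [y]; it yields both
    uniqueness of the lift and measurability of [fibre_point]. *)
Lemma lifts_coordP y u x n g : ~ N y -> lifts y u x ->
  x n = g <-> [/\ phi g = (y : Y) n, src G g \in C (iter n.+1 S y) &
    word_map (path_prefix n.+1 y) (src G g) = u].
Proof.
move=> nN [xy xu xC]; split=> [<-|[gy gC gu]].
  split; first by rewrite -xy.
    by rewrite path_adj.
  by rewrite path_adj -xu -[in LHS]xy start_word_map.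
have -> : g = lift_edge phi (y n) (src G g) by rewrite -gy lift_edgeK.
have <- : src G (x n) = src G g.
  apply: (C_word_inj nN _ gC); rewrite path_adj//.
  by rewrite gu -xu -[in LHS]xy start_word_map.
by rewrite -xy lift_edgeK.
Qed.

Lemma lifts_uniq y u x x' : ~ N y -> lifts y u x -> lifts y u x' -> x = x'.
Proof.
move=> nN xl xl'; apply: path_eqP => n.
by apply/(lifts_coordP _ _ nN xl); apply/(lifts_coordP _ _ nN xl').
Qed.

(** The constant value off the good set keeps the map measurable in [y]. *)
Definition fibre_point y u : X :=
  if `[< ~ N y /\ u \in C y >] then xget point (lifts y u) else point.

Lemma fibre_pointP y u : ~ N y -> u \in C y -> lifts y u (fibre_point y u).
Proof.
move=> nN uC; rewrite /fibre_point asboolT//.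
by apply: xgetPex; exact: lifts_ex.
Qed.

Lemma measurable_iter_preim n B : measurable B -> measurable (iter n S @^-1` B).
Proof.
by move=> mB; rewrite -[X in measurable X]setTI; exact: measurable_iter_shift.
Qed.

Lemma measurable_fibre_point u : measurable_fun setT (fibre_point ^~ u).
Proof.
apply: measurable_fun_path => n g.
pose D := ~` N `&` [set y | u \in C y].
have mD : measurable D by apply: measurableI => //; exact: measurableC.
pose B := [set y : Y | phi g = y n] `&` (iter n.+1 S @^-1` [set y | src G g \in C y]
  `&` [set y : Y | word_map (path_prefix n.+1 y) (src G g) = u]).
have mB : measurable B.
  apply: measurableI; first exact: (measurable_coord (G := BG) n (fun i => phi g = i)).
  apply: measurableI; first exact: measurable_iter_preim.
  exact: (measurable_path_prefix (G := BG) n.+1 (fun s => word_map s (src G g) = u)).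
rewrite (_ : mkset _ = (D `&` B) `|` (~` D `&` [set y | (point : X) n = g /\ setT y])).
  apply: measurableU; first exact: measurableI.
  by apply: measurableI; [exact: measurableC|exact: measurable_cst_and].
apply/seteqP; split=> y.
  rewrite /mkset /fibre_point; case: asboolP => [[nN uC]|nD pg]; last by right.
  move=> xg; left; split=> //; have xl := fibre_pointP nN uC.
  move: xg xl; rewrite /fibre_point asboolT// => xg xl.
  by have [] := (lifts_coordP n g nN xl).1 xg.
move=> [[[nN uC] [gy [gC gu]]]|[nD [pg _]]] /=.
  by apply/(lifts_coordP n g nN (fibre_pointP nN uC)).
by rewrite /fibre_point; case: asboolP.
Qed.

(** Since [startC] holds along almost every orbit, almost every path is itself the lift of its
    labels with its own end vertex. *)
Lemma fibre_point_factor : \forall x \ae mG,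
  ~ N (Phi x) /\ fibre_point (Phi x) (start x) = x.
Proof.
have xC : \forall x \ae mG, forall n, trm G ((x : X) n) \in C (iter n S (Phi x)).
  have := ae_iter (@measurable_markov_shift R G) (measure_shift phi mG_markov) startC.
  apply: filterS => x xC n; rewrite -factor_map_iter.
  by have := xC n; rewrite /start iter_markov_shiftE addn0.
have nN := ae_factor phi mG_markov mI_markov (measure0_aeN mN N0).
apply: filterS2 xC nN => x xC nN; split=> //.
by apply: (lifts_uniq nN (fibre_pointP nN (xC 0%N))); split.
Qed.

Lemma invd_ge0 : 0 <= (d%:R : R)^-1.
Proof. by rewrite invr_ge0. Qed.

Let dirac_at (x : X) : {measure set X -> \bar R} := \d_x.

Let uniform_fibre_measure y : {measure set X -> \bar R} :=
  mscale (NngNum invd_ge0)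
    (msum (fun k => dirac_at (fibre_point y (nth (start point) (C y) k))) #|` C y|).

(* On the null set [N] any measure would do. *)
Definition fibre_measure y : {measure set X -> \bar R} :=
  if `[< N y >] then dirac_at point else uniform_fibre_measure y.

Lemma fibre_measureE y A : ~ N y -> fibre_measure y A =
  (\sum_(u <- C y) d%:R^-1 * (fibre_point y u \in A)%:R)%:E.
Proof.
move=> nN; rewrite /fibre_measure asboolF//= /mscale/= /msum/=.
under eq_bigr do rewrite diracE.
by rewrite sumEFin -EFinM mulr_sumr (big_nth (start point)) big_mkord.
Qed.

Lemma fibre_measure_full y A : ~ N y ->
  (forall u, u \in C y -> A (fibre_point y u)) -> fibre_measure y A = 1%E.
Proof.
move=> nN CA; rewrite fibre_measureE// big_seq (eq_bigr (fun=> d%:R^-1)).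
  rewrite -big_seq big_const_seq count_predT iter_addr_0 -[size _]/(#|` C y|).
  have [-> _] := CN 0 nN.
  by rewrite -[X in X%:E]mulr_natr mulVf// pnatr_eq0 -lt0n.
by move=> u uC; rewrite mem_set ?mulr1//; exact: CA.
Qed.

Lemma fibre_measure1 y u : ~ N y -> u \in C y ->
  fibre_measure y [set fibre_point y u] = (d%:R^-1)%:E.
Proof.
move=> nN uC; rewrite fibre_measureE// (big_fsetD1 u)//= mem_set// mulr1.
rewrite big_seq big1 ?addr0// => v; rewrite !inE => /andP[vu vC].
rewrite memNset ?mulr0// => /= E; move: vu => /eqP; apply.
have [_ <- _] := fibre_pointP nN vC; have [_ <- _] := fibre_pointP nN uC.
by rewrite E.
Qed.

Lemma fibre_measureT y : fibre_measure y setT = 1%E.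
Proof.
have [Ny|nN] := pselect (N y); last exact: fibre_measure_full.
by rewrite /fibre_measure asboolT//; exact: diracT.
Qed.

Let weight (A : set X) n (y : Y) : \bar R := (if pickle_inv n is Some u then
  d%:R^-1 * (fibre_point y u \in A)%:R * (u \in C y)%:R else 0)%:E.

Let weight_ge0 A n y : (0 <= weight A n y)%E.
Proof.
by rewrite /weight lee_fin; case: pickle_inv => // u; rewrite !mulr_ge0 ?invd_ge0.
Qed.

Let fibre_measure_weight A y : ~ N y ->
  fibre_measure y A = (\sum_(n <oo) weight A n y)%E.
Proof.
by move=> nN; rewrite fibre_measureE// -series_fset// => u; rewrite mulr_ge0 ?invd_ge0.
Qed.

Let hit (A : set X) u := [set y | A (fibre_point y u)] `&` [set y | u \in C y].

Let measurable_hit A u : measurable A -> measurable (hit A u).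
Proof.
move=> mA; apply: measurableI => //.
by rewrite -[X in measurable X]setTI; exact: measurable_fibre_point.
Qed.

Let weightE A n u : pickle_inv n = Some u ->
  weight A n = (fun y => (d%:R^-1)%:E * (\1_(hit A u) y)%:E)%E.
Proof.
move=> nu; apply/funext => y; rewrite /weight nu -EFinM -mulrA -natrM mulnb.
by rewrite indicE in_setI; congr (_ * (nat_of_bool (_ && _))%:R)%:E;
  apply/idP/idP; rewrite !inE.
Qed.

Let measurable_weight A n : measurable A -> measurable_fun setT (weight A n).
Proof.
move=> mA; case E : (@pickle_inv (vertex G) n) => [u|]; last first.
  by rewrite /weight E; exact: measurable_cst.
rewrite (weightE A E); apply: emeasurable_funM => //.
by apply/measurable_EFinP; apply: measurable_indic; exact: measurable_hit.
Qed.

Lemma measurable_fibre_measure A : measurable A ->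
  measurable_fun setT (fibre_measure ^~ A).
Proof.
move=> mA.
rewrite (_ : fibre_measure ^~ A =
    fun y => if `[< N y >] then dirac_at point A else (\sum_(n <oo) weight A n y)%E).
  apply: measurable_fun_ifT => //.
    apply: (measurable_fun_bool true); rewrite setTI.
    rewrite (_ : _ @^-1` _ = N)//; apply/seteqP; split=> y /=; first by move/asboolP.
    by move=> Ny; exact/asboolP.
  by apply: ge0_emeasurable_sum => n *; [exact: weight_ge0|exact: measurable_weight].
apply/funext => y; case: asboolP => [Ny|nN]; last exact: fibre_measure_weight.
by rewrite /fibre_measure asboolT.
Qed.

(** Term by term over the end vertex [u]: almost every path ending at [u] is
    [fibre_point (Phi x) u], so its membership in [A] is a condition on the labels, and [CE]
    applies. *)
Lemma integral_fibre_measure A : measurable A ->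
  mG A = (\int[mI]_y fibre_measure y A)%E.
Proof.
move=> mA.
have -> : (\int[mI]_y fibre_measure y A = \int[mI]_y \sum_(n <oo) weight A n y)%E.
  apply: ge0_ae_eq_integral => //.
  - exact: measurable_fibre_measure.
  - by apply: ge0_emeasurable_sum => n *; [exact: weight_ge0|exact: measurable_weight].
  - by move=> y _; apply: nneseries_ge0 => n _ _; exact: weight_ge0.
  - apply: filterS (measure0_aeN mN N0) => y nN _.
    exact: fibre_measure_weight.
rewrite integral_nneseries//; last by move=> n; exact: measurable_weight.
pose V (x : X) := choice.pickle (start x).
have mV k : measurable (V @^-1` [set k]).
  exact: (measurable_start [set u | choice.pickle u = k]).
rewrite (measure_sum_fibres mG mA mV); apply: eq_eseriesr => n _.
case E : (@pickle_inv (vertex G) n) => [u|]; last first.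
  rewrite (_ : V @^-1` _ = set0) ?setI0 ?measure0.
    by rewrite integral0_eq// => y _; rewrite /weight E.
  by apply/seteqP; split=> // x /= Vx; move: E; rewrite -Vx pickleK_inv.
have un : choice.pickle u = n by have := @pickle_invK (vertex G) n; rewrite E.
have mAu : measurable [set y | A (fibre_point y u)].
  by rewrite -[X in measurable X]setTI; exact: measurable_fibre_point.
under eq_integral do rewrite (weightE A E).
rewrite ge0_integralZl_EFin//; last first.
  by apply/measurable_EFinP; apply: measurable_indic; exact: measurable_hit.
rewrite integral_indic//; last exact: measurable_hit.
rewrite setIT -[RHS]/((d%:R^-1)%:E * mI (_ `&` _))%E -CE//.
apply: eq_measure_ae.
- by apply: measurableI => //; exact: mV.
- apply: measurableI; first exact: (measurable_start [set u]).
  exact: measurable_preim_factor.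
- apply: filterS fibre_point_factor => x [_ xE]; rewrite /V -un; split.
    move=> [Ax /= /(pcan_inj choice.pickleK) xu]; split=> //.
    by rewrite /preimage /mkset -xu xE.
  by move=> [/= xu]; rewrite /preimage /mkset -xu xE.
Qed.

Lemma fibre_is_degree : is_degree mG mI phi d.
Proof.
have [k kE] := prob_kernel_ex measurable_fibre_measure fibre_measureT.
have aeN := measure0_aeN mN N0; exists k; split; first split.
- apply: filterS aeN => y nN; rewrite kE; apply: fibre_measure_full => // u uC.
  by have [] := fibre_pointP nN uC.
- move=> A mA; rewrite integral_fibre_measure//.
  by apply: eq_integral => y _; rewrite kE.
- apply: filterS aeN => y nN.
  exists [set fibre_point y u | u in [set` C y]]; split.
  + by move=> _ [u uC <-]; have [] := fibre_pointP nN uC.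
  + apply: (@card_eq_trans _ _ _ _ [set` C y]).
      apply: inj_card_eq => u v; rewrite !inE => uC vC uv.
      have [_ <- _] := fibre_pointP nN uC; have [_ <- _] := fibre_pointP nN vC.
      by rewrite uv.
    by apply/card_eq_fsetP; have [] := CN 0 nN.
  + by rewrite kE; apply: fibre_measure_full => // u uC; exists u.
  + by move=> _ [u uC <-]; rewrite kE fibre_measure1.
Qed.

(** The elements of the join are the nonempty fibres of [Phi], so the measure attached to [x] is the
    fibre measure over [Phi x]. *)
Lemma fibre_is_index : is_index mG T (delta_partition phi) d%:R.
Proof.
split; first by rewrite ltr0n.
pose m (x : X) := fibre_measure (Phi x).
have mm A : measurable A -> measurable_fun setT (m ^~ A).
  move=> mA; apply: measurableT_comp (measurable_fibre_measure mA) _.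
  exact: measurable_factor_map.
have [k kE] := prob_kernel_ex mm (fun x => fibre_measureT (Phi x)).
have elementP D x x' : join_preimages T (delta_partition phi) D -> D x ->
    D x' <-> Phi x = Phi x'.
  move=> [_ [A [Adelta ->]]] Dx; split=> [Dx'|xx'].
    apply: path_eqP => n; have := Dx n Logic.I; have := Dx' n Logic.I.
    have [i _ <-] := Adelta n; rewrite /preimage /mkset !iter_markov_shiftE !addn0.
    by rewrite /= => -> ->.
  move=> n _; have := Dx n Logic.I.
  have [i _ <-] := Adelta n; rewrite /preimage /mkset !iter_markov_shiftE !addn0.
  by rewrite -[phi (x n)]/(Phi x n) xx'.
exists k; split; first split.
- move=> D x x' DP Dx Dx' A mA; rewrite !kE /m.
  by have -> : Phi x = Phi x' by apply/(elementP D x x' DP Dx).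
- apply: filterS fibre_point_factor => x [nN _] D DP Dx; rewrite kE.
  apply: fibre_measure_full => // u uC.
  apply/(elementP D x _ DP Dx).
  by have [] := fibre_pointP nN uC.
- move=> A mA; rewrite integral_fibre_measure//.
  have -> : (\int[mG]_x k x A = \int[mG]_x ((fibre_measure ^~ A) \o Phi) x)%E.
    by apply: eq_integral => x _; rewrite kE.
  rewrite -[[set: X]](preimage_setT Phi) -ge0_integral_pushforward//.
  + apply: eq_measure_integral; first exact: measurable_factor_map.
    by move=> mf B mB _; exact: esym (measure_factor phi mG_markov mI_markov mB).
  + exact: measurable_factor_map.
  + exact: measurable_fibre_measure.
- apply: filterS2 fibre_point_factor startC => x [nN xE] xC.
  by rewrite kE /m -[X in [set X]]xE fibre_measure1.
Qed.

End fibre_measure.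

(** * Contractivity of the vertex semigroup *)

(** Maps into [L] give the upper bound; the finite set [L] itself attains it. *)
Lemma d_contractive_degree (R : realType) (U : countType) (d : nat)
  (F : set (U -> U)) : d_contractive d F -> semigroup_degree R F = (d%:R)%:E.
Proof.
move=> [L [Ld Fd FL]]; apply/eqP; rewrite eq_le; apply/andP; split.
  apply: ge_ereal_sup => _ [E _ <-]; have [g Fg gE] := FL E.
  apply: ereal_inf_le; exists (#|` [fset g x | x in E]%fset|%:R)%:E; first by exists g.
  by rewrite lee_fin ler_nat -Ld; exact: fsubset_leq_card.
apply: le_trans (ereal_sup_ubound _); last by exists L.
by apply: le_ereal_inf_tmp => _ [g Fg <-]; rewrite Fd.
Qed.

(* A weak density theorem: otherwise [m (B `&` _) <= (1 - e) m] on cylinders, hence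
   on [B]. *)
Lemma density_cylinder (R : realType) (H : stochGraph R)
    (m : probability (path_space H) R) (B : set (path_space H)) (e : R) :
  measurable B -> (0 < m B)%E -> 0 < e -> e <= 1 ->
  exists n (x : path_space H),
    ((1 - e)%:E * m (cylinder n x) < m (B `&` cylinder n x))%E.
Proof.
move=> mB B0 e0 e1; apply: contrapT => nx.
have e1' : 0 <= 1 - e by rewrite subr_ge0.
have : (mrestr m mB B <= mscale (NngNum e1') m B)%E.
  apply: path_measure_le => //.
  - by rewrite /= /mrestr setTI -ge0_fin_numE// fin_num_measure.
  - by rewrite /= /mscale /= probability_setT mule1 ltry.
  move=> n x; rewrite /= /mrestr /mscale /= leNgt setIC.
  by apply/negP => lt_nx; apply: nx; exists n, x.
have /fineK BE : m B \is a fin_num by exact: fin_num_measure.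
rewrite /mrestr setIid /mscale/=; move: B0; rewrite -BE -EFinM !lte_fin lee_fin.
by move=> B0; nra.
Qed.

(** Here [k] is the mass of a cylinder, [a] the mass over it of the paths ending in [L], and [p] the
    mass of a vertex. *)
Lemma mass_gap (R : realFieldType) (e a k p : R) :
  0 <= k -> e <= p -> (1 - e) * k < a -> ~ (a + k * p <= k).
Proof. by move=> k0 ep ka ak; nra. Qed.

Section contractive.
Variables (R : realType) (G : stochGraph R) (I : countType) (rho : I -> R).
Variables (rho_gt0 : forall i, 0 < rho i).
Variables (rho_sum1 : (\esum_(i in [set: I]) (rho i)%:E = 1)%E).
Local Notation BG := (bernoulli_graph rho_gt0 rho_sum1).
Variable phi : graph_hom G BG.
Variable mG : probability (path_space G) R.
Hypothesis mG_markov : is_markov_measure mG.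
Variable mI : probability (path_space BG) R.
Hypothesis mI_markov : is_markov_measure mI.

Local Notation X := (path_space G).
Local Notation Y := (path_space BG).
Local Notation T := (@markov_shift R G).
Local Notation S := (@markov_shift R BG).
Local Notation Phi := (factor_map phi).
Local Notation f := (vertex_map phi).
Local Notation label := (label phi).

Variables (C : Y -> {fset vertex G}) (d : nat) (N : set Y).
Hypothesis mC : forall u, measurable [set y | u \in C y].
Hypothesis startC : \forall x \ae mG, start x \in C (Phi x).
Hypothesis mN : measurable N.
Hypothesis N0 : mI N = 0%E.
Hypothesis CN : forall y, ~ N y -> #|` C y| = d /\
  C y = [fset f ((y : Y) 0%N) v | v in C (S y)]%fset.

Local Notation word_map := (word_map phi).

Lemma vertex_semigroupP g :
  vertex_semigroup phi g <-> exists i w, g = word_map (i :: w).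
Proof.
split=> [|[i [w ->]]].
  elim=> [i|g1 g2 _ [i [w ->]] _ [j [w' ->]]]; first by exists i, [::].
  exists i, (w ++ j :: w'); apply/funext => v.
  by rewrite /word_map /= foldr_cat.
elim: w i => [|j w IH] i; first exact: generated_gen.
exact: generated_comp (generated_gen _ i) (IH j).
Qed.

Lemma null_ycons i B : measurable B -> mI B = 0%E -> mI (ycons i @^-1` B) = 0%E.
Proof.
move=> mB B0; have : mI ([set y : Y | y 0%N = i] `&` B) = 0%E.
  apply: (subset_measure0 _ mB _ B0); last by move=> y [].
  by apply: measurableI => //; exact: (measurable_coord (G := BG) 0 (fun j => j = i)).
rewrite (measure_ycons phi mG_markov mI_markov)// => /eqP.
by rewrite mule_eq0 eqe gt_eqF//= => /eqP.
Qed.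

Let wcons (w : seq I) (y : Y) : Y := foldr (fun i (z : Y) => ycons i z) y w.

(** Putting a label in front pulls null sets back to null sets because [rho i] is positive, and
    there are countably many words. *)
Lemma ae_wcons : \forall y \ae mI, forall w, ~ N (wcons w y).
Proof.
apply: ae_forall_countType => w.
suff [mw w0] : measurable (wcons w @^-1` N) /\ mI (wcons w @^-1` N) = 0%E.
  exact: measure0_aeN mw w0.
move: mN N0; elim: w N => [|i w IH] B mB B0 //.
apply: (IH (ycons i @^-1` B)); first exact: measurable_preim_ycons.
exact: null_ycons.
Qed.

Lemma wcons_vertices y w : (forall w, ~ N (wcons w y)) ->
  C (wcons w y) = [fset word_map w v | v in C y]%fset.
Proof.
move=> nN; elim: w => [|i w IH].
  by apply/fsetP => v; apply/idP/imfsetP => [vC|[u uC ->//]]; exists v.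
have [_ ->] := CN (nN (i :: w)).
rewrite [S _](shift_ycons i (wcons w y)) IH.
apply/fsetP => v; apply/imfsetP/imfsetP => /= [[_ /imfsetP[u uC ->] ->]|[u uC ->]].
  by exists u.
by exists (word_map w u) => //; apply/imfsetP; exists u.
Qed.

(** Independence of the labels 0 to [n] from the path before them, obtained one label at a time. *)
Lemma measure_cylinder_shift n (y : Y) A : measurable A ->
  mG (Phi @^-1` cylinder n y `&` iter n.+1 T @^-1` A) =
  (mI (cylinder n y) * mG A)%E.
Proof.
have miter k B : measurable B -> measurable (iter k T @^-1` B).
  by move=> mB; rewrite -[X in measurable X]setTI; exact: measurable_iter_shift.
move=> mA; elim: n y => [|n IH] y.
  rewrite -(measure_factor phi mG_markov mI_markov); last exact: measurable_cylinder.
  have -> : Phi @^-1` cylinder 0 y = [set x | label x = y 0%N].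
    by apply/seteqP; split=> x; [exact|move=> xy []].
  by rewrite measure_label_shift// measure_label.
have cylE : cylinder n.+1 y = [set z : Y | z 0%N = y 0%N] `&` S @^-1` cylinder n (S y).
  apply/seteqP; split=> z; last by move=> [z0 zy] [|k] // kn; exact: zy.
  by move=> zy; split; [exact: zy|move=> k kn; exact: (zy k.+1)].
rewrite [in RHS]cylE (measure_bernoulli_shift phi mG_markov mI_markov); last first.
  exact: measurable_cylinder.
rewrite -muleA -IH -(measure_label_shift phi mG_markov); last first.
  apply: measurableI; last exact: miter.
  by apply: measurable_preim_factor; exact: measurable_cylinder.
congr (mG _); rewrite cylE; apply/seteqP.
split=> x; rewrite /preimage /mkset /setI /= => -[].
  by move=> [x0 xy] xA; split=> //; split; [exact: xy|rewrite -iterS iterSr in xA].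
by move=> x0 [xy xA]; split; [split|rewrite -iterSr in xA].
Qed.

Lemma measure_start_gt0 u : (0 < mG [set x | start x = u])%E.
Proof.
have [g gu] := trm_surj u.
apply: (@lt_le_trans _ _ (mG (cylinder 0 (fun=> g)))).
  by rewrite mG_markov// lte_fin big_ord_recl big_ord0 mulr1 mulr_gt0 ?wt_gt0 ?p0_gt0.
apply: le_measure; rewrite ?inE.
- exact: measurable_cylinder.
- exact: (measurable_start [set u]).
- by move=> x /(_ 0%N isT) xg; rewrite /= /start xg.
Qed.

Lemma fibre_contractive : d_contractive d (vertex_semigroup phi).
Proof.
have mCL L : measurable [set y | C y = L].
  rewrite (_ : mkset _ = \bigcap_u [set y | (u \in C y) = (u \in L)]).
    apply: measurable_bigcap_countType => u; case: (u \in L); first exact: mC.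
    rewrite (_ : mkset _ = ~` [set y | u \in C y]); first exact: measurableC.
    by apply/seteqP; split=> y /=; [move=> ->|move=> /negP/negbTE].
  apply/seteqP; split=> y /=; first by move=> CL u _; rewrite /= CL.
  by move=> CL; apply/fsetP => u; exact: (CL u Logic.I).
(* [C] takes values in the countable type of finite sets of vertices. *)
have [L L0] : exists L, (0 < mI [set y | C y = L])%E.
  apply: contrapT => /forallNP L0.
  have : \forall y \ae mI, forall L, C y <> L.
    apply: ae_forall_countType => L; apply: (measure0_aeN (mCL L)).
    by apply/eqP; rewrite -measure_le0 leNgt; apply/negP; exact: L0.
  move=> nC; have : mI set0 = 1%E.
    by apply: ae_prob1 => //; apply: filterS nC => y /(_ (C y)).
  by rewrite measure0 => /eqP; rewrite eqe eq_sym oner_eq0.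
have [y yL yN] : exists2 y, C y = L & forall w, ~ N (wcons w y).
  apply: contrapT => ny; move: L0; rewrite (_ : mI _ = 0%E) ?ltxx//.
  apply: ae_measure0 => //; apply: filterS ae_wcons => y yN yL.
  by apply: ny; exists y.
exists L; split.
- by rewrite -yL; have [] := CN (yN [::]).
- move=> g /vertex_semigroupP[i [w ->]].
  by rewrite -yL -wcons_vertices//; have [] := CN (yN (i :: w)).
(* [e] bounds from below the mass of every vertex of [E]; a cylinder on which [C y = L] has
   conditional probability above [1 - e] will leave no room for a vertex of [E] sent outside [L]. *)
move=> E; have [e [e0 e1 eE]] : exists e : R, [/\ 0 < e, e <= 1 &
    forall u, u \in enum_fset E -> e <= fine (mG [set x | start x = u])].
  elim: (enum_fset E) => [|u s [e [e0 e1 es]]]; first by exists 1.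
  exists (Num.min e (fine (mG [set x | start x = u]))); split.
  - rewrite lt_min e0 fine_gt0// measure_start_gt0/= -ge0_fin_numE//.
    by apply: fin_num_measure; exact: (measurable_start [set u]).
  - by rewrite ge_min e1.
  - by move=> v; rewrite inE => /predU1P[->|/es vs]; rewrite ge_min ?lexx ?orbT// vs.
have [n [z]] := density_cylinder (mCL L) L0 e0 e1.
set K := cylinder n z => Kz.
have mK : measurable K by exact: measurable_cylinder.
exists (word_map (path_prefix n.+1 z)).
  by apply/vertex_semigroupP; exists (z 0%N), [seq z k | k <- iota 1 n].
apply/fsubsetP => _ /imfsetP[u uE ->]; apply: contraT => uL.
have mu : measurable [set x : X | start x = u] by exact: (measurable_start [set u]).
have mL : measurable [set x : X | start x \in L].
  exact: (measurable_start [set u | u \in L]).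
(* If the word sends [u] outside [L], the paths over [K] that end in [L] and those that stood at [u]
   before the last [n.+1] steps are disjoint. Their masses are more than [1 - e] and at least [e]
   times that of [K], which is too much. *)
pose A1 := Phi @^-1` K `&` [set x | start x \in L].
pose A2 := Phi @^-1` K `&` iter n.+1 T @^-1` [set x | start x = u].
have mPK : measurable (Phi @^-1` K) by exact: measurable_preim_factor.
have mA1 : measurable A1 by exact: measurableI.
have mA2 : measurable A2.
  by apply: measurableI => //; rewrite -[X in measurable X]setTI; exact: measurable_iter_shift.
have A12 : A1 `&` A2 = set0.
  apply/seteqP; split=> // x [[xK xL] [_ xu]]; move/negP: uL; apply.
  have <- : trm G (x n.+1) = u.
    have : start (iter n.+1 T x) = u by exact: xu.
    by rewrite /start iter_markov_shiftE addn0.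
  have -> : path_prefix n.+1 z = path_prefix n.+1 (Phi x).
    by apply/path_prefixP => k kn; rewrite xK.
  by rewrite start_word_map.
have leB : (mI ([set y | C y = L] `&` K) <= mG A1)%E.
  rewrite -(measure_factor phi mG_markov mI_markov); last exact: measurableI.
  apply: le_measure_ae => //.
    by apply: measurable_preim_factor; exact: measurableI.
  by apply: filterS startC => x xC [/= xL xK]; split=> //=; rewrite -xL.
have : (mG A1 + mG A2 <= mI K)%E.
  rewrite -measureU// -(measure_factor phi mG_markov mI_markov)//.
  apply: le_measure; rewrite ?inE//; first exact: measurableU.
  by move=> x [[]|[]].
rewrite /A2 measure_cylinder_shift// -/K.
have aE : mG A1 = (fine (mG A1))%:E by rewrite fineK// fin_num_measure.
have kE : mI K = (fine (mI K))%:E by rewrite fineK// fin_num_measure.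
have pE : mG [set x | start x = u] = (fine (mG [set x | start x = u]))%:E.
  by rewrite fineK// fin_num_measure.
have := lt_le_trans Kz leB; rewrite aE kE pE -!EFinM -EFinD lee_fin lte_fin.
by move=> ka /(mass_gap (fine_ge0 (measure_ge0 mI K)) (eE u uE) ka).
Qed.

End contractive.

Theorem theorem3p21 (R : realType) (G : stochGraph R)
    (I : countType) (rho : I -> R)
    (rho_gt0 : forall i, 0 < rho i)
    (rho_sum1 : (\esum_(i in [set: I]) (rho i)%:E = 1)%E)
    (mG : probability (path_space G) R)
    (mG_markov : is_markov_measure mG)
    (mI : probability (path_space (bernoulli_graph rho_gt0 rho_sum1)) R)
    (mI_markov : is_markov_measure mI)
    (TG_ergodic : ergodic mG (@markov_shift R G))
    (G_uniform : rho_uniform rho_gt0 rho_sum1 G)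
    (phi : graph_hom G (bernoulli_graph rho_gt0 rho_sum1)) :
  exists d : nat,
    [/\ d_contractive d (vertex_semigroup phi),
        semigroup_degree R (vertex_semigroup phi) = (d%:R)%:E,
        is_index mG (@markov_shift R G) (delta_partition phi) d%:R &
        is_degree mG mI phi d].
Proof.
have [C [d [d0 mC CE startC stepC]]] :=
  fibre_vertices_ex phi mG_markov mI_markov TG_ergodic.
(* A single null set [N], off which the properties in [stepC] hold along the whole orbit of [y]. *)
have [N [mN N0 NP]] := ae_iter (@measurable_markov_shift R _)
  (measure_shift_bernoulli phi mG_markov mI_markov) stepC.
have CN (y : path_space (bernoulli_graph rho_gt0 rho_sum1)) n : ~ N y ->
    #|` C (iter n (@markov_shift R _) y)| = d /\
    C (iter n (@markov_shift R _) y) =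
      [fset vertex_map phi (y n) v | v in C (iter n.+1 (@markov_shift R _) y)]%fset.
  move=> nN; have [Cd Cn] := contrapT (fun h => nN (NP y h)) n.
  by split=> //; rewrite [LHS]Cn iter_markov_shiftE addn0.
have contractive : d_contractive d (vertex_semigroup phi).
  apply: (fibre_contractive mG_markov mI_markov mC startC mN N0) => y.
  exact: (CN y 0%N).
exists d; split=> //; first exact: d_contractive_degree.
  exact: (fibre_is_index mG_markov mI_markov d0 mC CE startC mN N0 CN).
exact: (fibre_is_degree mG_markov mI_markov d0 mC CE startC mN N0 CN).
Qed.
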